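(* Let $n\in\mathbb{N}$, $1\le p<\infty$ and $1\le q<\infty$. Then for any compact set $K\subset\mathbb{R}^n$, $$\lim_{\alpha\to0+}\alpha^{p/q}\,\operatorname{cap}(K;B_{p,q}^\alpha)=2n^p\left(\frac1q\right)^{p/q}|K|,$$ where $|K|$ denotes the Lebesgue measure of $K$.
   Context: Here $e_k$ is the $k$th unit coordinate vector. For $f\in L^p(\mathbb{R}^n)$, $1\le p<\infty$, the partial modulus of continuity is $$\omega_k(f;\delta)_p=\sup_{0\le h\le\delta}\left(\int_{\mathbb{R}^n}|f(x+he_k)-f(x)|^p\,dx\right)^{1/p}.$$ For $0<\alpha<1$, $1\le p,q<\infty$, $$\|f\|_{b^\alpha_{p,q;k}}=\left(\int_0^\infty\left(t^{-\alpha}\omega_k(f;t)_p\right)^q\frac{dt}{t}\right)^{1/q},\qquad \|f\|_{b^\alpha_{p,q}}=\sum_{k=1}^n\|f\|_{b^\alpha_{p,q;k}}.$$ For a compact set $K\subset\mathbb{R}^n$, let $\mathfrak{N}(K)$ be the set of all $f\in C_0^\infty(\mathbb{R}^n)$ (smooth, compactly supported) such that $f(x)\ge1$ for all $x\in K$. Define $$\operatorname{cap}(K;B_{p,q}^\alpha)=\inf\left\{\|f\|_{b^\alpha_{p,q}}^p: f\in\mathfrak{N}(K)\right\}.$$ *)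

(* Defs.v *)
From HB Require Import structures.
From mathcomp Require Import all_boot all_order all_algebra.
From mathcomp Require Import all_classical all_reals all_analysis.

Set Implicit Arguments.
Unset Strict Implicit.
Unset Printing Implicit Defensive.
Import Order.TTheory GRing.Theory Num.Theory.
Import numFieldNormedType.Exports.

Local Open Scope classical_set_scope.
Local Open Scope ring_scope.

(* R^n is 'rV[R]_n, with its library topology and normed module structure.
   Its sigma-algebra is the product one, generated by the coordinate
   projections (R carrying its Borel sets); it is the Borel sigma-algebra. *)

Definition measure_rV_display : measure_display.
Proof. exact: default_measure_display. Qed.

Section measurable_rV.
Context (R : realType) (n : nat).

Definition rV_coor (i : 'I_n) (x : 'rV[R]_n) : measurableTypeR R := x ord0 i.

Let rV_set0 : g_sigma_preimage rV_coor set0.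
Proof. exact: sigma_algebra0. Qed.

Let rV_setC A : g_sigma_preimage rV_coor A -> g_sigma_preimage rV_coor (~` A).
Proof. exact: sigma_algebraC. Qed.

Let rV_bigcup (F : _^nat) : (forall i, g_sigma_preimage rV_coor (F i)) ->
  g_sigma_preimage rV_coor (\bigcup_i (F i)).
Proof. exact: sigma_algebra_bigcup. Qed.

HB.instance Definition _ := @isMeasurable.Build measure_rV_display
  'rV[R]_n (g_sigma_preimage rV_coor) rV_set0 rV_setC rV_bigcup.

End measurable_rV.

Lemma measurable_rV_coor (R : realType) (n : nat) (i : 'I_n) :
  measurable_fun [set: 'rV[R]_n] (@rV_coor R n i).
Proof.
move=> _ Y mY; rewrite setTI; apply: sub_sigma_algebra => /=.
rewrite -bigcup_seq/=; exists i => /=; first by rewrite mem_index_enum.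
by exists Y => //; rewrite setTI.
Qed.

Lemma measurable_fun_rV d (T : measurableType d) (R : realType) (n : nat)
    (f : T -> 'rV[R]_n) :
  (forall i, measurable_fun setT (@rV_coor R n i \o f)) -> measurable_fun setT f.
Proof.
move=> mf; rewrite /measurable_fun => _ Y mY; rewrite setTI; move: Y mY.
pose G := [set Y : set 'rV[R]_n | measurable (f @^-1` Y)].
suff : @measurable _ 'rV[R]_n `<=` G by [].
apply: smallest_sub.
  split; rewrite /G /=.
  - by rewrite preimage_set0.
  - by move=> A mA; rewrite setTD preimage_setC; exact: measurableC.
  - by move=> F mF; rewrite preimage_bigcup; exact: bigcup_measurable.
rewrite -bigcup_seq => A [i _ [B mB <-]]; rewrite /G /= setTI.
by rewrite -comp_preimage -[X in measurable X]setTI; exact: mf.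
Qed.

Section lebesgue_rV_succ.
Context (R : realType) (n : nat).

Definition rV_cons (p : measurableTypeR R * 'rV[R]_n) : 'rV[R]_n.+1 :=
  row_mx (const_mx p.1 : 'rV[R]_1) p.2.

Definition rV_uncons (x : 'rV[R]_n.+1) : measurableTypeR R * 'rV[R]_n :=
  (x ord0 ord0, \row_i x ord0 (lift ord0 i)).

Lemma rV_cons0 p : rV_cons p ord0 ord0 = p.1.
Proof.
rewrite /rV_cons; have -> : ord0 = lshift n (ord0 : 'I_1) by apply: val_inj.
by rewrite (row_mxEl (const_mx p.1 : 'rV[R]_1)) mxE.
Qed.

Lemma rV_consS p i : rV_cons p ord0 (lift ord0 i) = p.2 ord0 i.
Proof.
rewrite /rV_cons; have -> : lift ord0 i = rshift 1 i by apply: val_inj.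
by rewrite (row_mxEr (const_mx p.1 : 'rV[R]_1)).
Qed.

Lemma rV_consK : cancel rV_cons rV_uncons.
Proof.
move=> [a x]; rewrite /rV_uncons rV_cons0; congr pair.
by apply/rowP => i; rewrite mxE rV_consS.
Qed.

Lemma measurable_rV_cons : measurable_fun setT rV_cons.
Proof.
apply: measurable_fun_rV => i; case: (unliftP ord0 i) => [j ->|->].
  rewrite (_ : _ \o _ = @rV_coor R n j \o snd); last first.
    by apply/funext => p /=; rewrite /rV_coor rV_consS.
  by apply: measurableT_comp => //; exact: measurable_rV_coor.
rewrite (_ : _ \o _ = fst) //.
by apply/funext => p /=; rewrite /rV_coor rV_cons0.
Qed.

Lemma measurable_rV_uncons : measurable_fun setT rV_uncons.
Proof.
apply/measurable_fun_pairP; split; first exact: measurable_rV_coor.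
apply: measurable_fun_rV => i.
rewrite (_ : _ \o _ = @rV_coor R n.+1 (lift ord0 i)); last first.
  by apply/funext => x /=; rewrite /rV_coor mxE.
exact: measurable_rV_coor.
Qed.

Variable m : {sigma_finite_measure set 'rV[R]_n -> \bar R}.

Definition lebesgue_rV_succ : set 'rV[R]_n.+1 -> \bar R :=
  pushforward (lebesgue_measure \x m)%E rV_cons.

Let succ0 : lebesgue_rV_succ set0 = 0%E.
Proof. by rewrite /lebesgue_rV_succ /pushforward preimage_set0 measure0. Qed.

Let succ_ge0 A : (0 <= lebesgue_rV_succ A)%E.
Proof. by rewrite /lebesgue_rV_succ /pushforward; exact: measure_ge0. Qed.

Let succ_sigma_additive : semi_sigma_additive lebesgue_rV_succ.
Proof.
move=> F mF tF mUF; rewrite /lebesgue_rV_succ /pushforward preimage_bigcup.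
apply: measure_semi_sigma_additive.
- move=> k; rewrite -[X in measurable X]setTI; exact: measurable_rV_cons.
- apply/trivIsetP => /= i j _ _ ij; rewrite -preimage_setI.
  by move/trivIsetP : tF => /(_ _ _ _ _ ij) ->//; rewrite preimage_set0.
- rewrite -preimage_bigcup -[X in measurable X]setTI.
  exact: measurable_rV_cons.
Qed.

HB.instance Definition _ := isMeasure.Build _ _ _ lebesgue_rV_succ
  succ0 succ_ge0 succ_sigma_additive.

Let succ_sigma_finite : sigma_finite setT lebesgue_rV_succ.
Proof.
have /sigma_finiteP[F [TF ndF Foo]] := sigma_finiteT (@lebesgue_measure R).
have /sigma_finiteP[G [TG ndG Goo]] := sigma_finiteT m.
exists (fun k => rV_uncons @^-1` (F k `*` G k)).
  rewrite -preimage_bigcup; apply/seteqP; split => // x _ /=.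
  have [k _ Fk] : (\bigcup_i F i) (rV_uncons x).1 by rewrite -TF.
  have [l _ Gl] : (\bigcup_i G i) (rV_uncons x).2 by rewrite -TG.
  exists (maxn k l) => //; split.
    by move: Fk; exact/subsetPset/ndF/leq_maxl.
  by move: Gl; exact/subsetPset/ndG/leq_maxr.
move=> k; have [mF Fk_fin] := Foo k; have [mG Gk_fin] := Goo k; split.
  rewrite -[X in measurable X]setTI.
  by apply: measurable_rV_uncons => //; exact: measurableX.
rewrite /lebesgue_rV_succ /pushforward -comp_preimage.
rewrite (_ : rV_uncons \o rV_cons = id); last first.
  by apply/funext => p /=; rewrite rV_consK.
by rewrite preimage_id product_measure1E// lte_mul_pinfty// ge0_fin_numE.
Qed.

HB.instance Definition _ := Measure_isSigmaFinite.Build _ _ _ lebesgue_rV_succ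
  succ_sigma_finite.

End lebesgue_rV_succ.

(* Lebesgue measure on R^n, as the n-fold product of lebesgue_measure. *)
Fixpoint lebesgue_rV (R : realType) (n : nat) :
    {sigma_finite_measure set 'rV[R]_n -> \bar R} :=
  match n with
  | 0 => \d_(0 : 'rV[R]_0)
  | n'.+1 => lebesgue_rV_succ (lebesgue_rV R n')
  end.

Lemma lebesgue_rV_box (R : realType) (n : nat) (a b : 'rV[R]_n) :
  (forall i, a ord0 i <= b ord0 i) ->
  lebesgue_rV R n [set x | forall i, a ord0 i <= x ord0 i <= b ord0 i] =
  (\prod_(i < n) (b ord0 i - a ord0 i))%:E.
Proof.
elim: n a b => [|n IHn] a b ab.
  by rewrite big_ord0 /= diracE mem_set // => -[].
pose a' : 'rV[R]_n := \row_i a ord0 (lift ord0 i).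
pose b' : 'rV[R]_n := \row_i b ord0 (lift ord0 i).
have ab' i : a' ord0 i <= b' ord0 i by rewrite !mxE.
rewrite big_ord_recl /= /lebesgue_rV_succ /pushforward.
rewrite [X in (_ \x _)%E X](_ : _ = `[a ord0 ord0, b ord0 ord0]%classic `*`
    [set x : 'rV[R]_n | forall i, a' ord0 i <= x ord0 i <= b' ord0 i]); last first.
  apply/seteqP; split => -[c x] /=.
    move=> h; split; first by have := h ord0; rewrite rV_cons0 in_itv.
    by move=> i; have := h (lift ord0 i); rewrite rV_consS !mxE.
  move=> [hc hx] i; case: (unliftP ord0 i) => [j ->|->].
    by rewrite rV_consS; have := hx j; rewrite !mxE.
  by rewrite rV_cons0; move: hc; rewrite in_itv.
rewrite product_measure1E //; last first.
  rewrite (_ : [set x | _] = \bigcap_(i in [set: 'I_n])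
      (@rV_coor R n i @^-1` `[a' ord0 i, b' ord0 i])); last first.
    apply/seteqP; split => x /= h i; first by move=> _; rewrite /= in_itv /=.
    by have := h i I; rewrite /= in_itv.
  apply: fin_bigcap_measurable => // i _.
  rewrite -[X in measurable X]setTI.
  by apply: measurable_rV_coor => //; exact: measurable_itv.
rewrite IHn //.
rewrite EFinM; congr (_ * _)%E.
  rewrite [LHS](@lebesgue_measure_itv R `[a ord0 ord0, b ord0 ord0]) /=.
  rewrite lte_fin; case: ltP => // ba.
  by rewrite (@le_anti _ _ (a ord0 ord0) (b ord0 ord0)) ?subrr // ab ba.
by congr EFin; apply: eq_bigr => i _; rewrite !mxE.
Qed.

Section besov.
Context (R : realType) (n : nat).
Implicit Types (f : 'rV[R]_n -> R) (k : 'I_n) (K : set 'rV[R]_n).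

Definition unit_vector k : 'rV[R]_n := delta_mx ord0 k.

(* For s = [:: k1; ...; kr] this is the partial derivative along e_kr, ...,
   then e_k1; smooth is C^oo: every such iterated partial derivative exists
   and is continuous. *)
Definition iterated_partial (s : seq 'I_n) f : 'rV[R]_n -> R :=
  foldr (fun k g => 'D_(unit_vector k) g) f s.

Definition smooth f :=
  forall s : seq 'I_n,
    continuous (iterated_partial s f) /\
    (forall x k, derivable (iterated_partial s f) x (unit_vector k)).

Definition compactly_supported f := compact (closure [set x | f x != 0]).

(* Lnorm mu p%:E g unfolds to (\int[mu]_x `|g x| `^ p) `^ p^-1. The moduli,
   the Besov norms and the capacity take values in \bar R, so that the
   supremum, the integrals and the infimum need no finiteness side condition. *)
Definition partial_modulus k f (delta p : R) : \bar R :=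
  ereal_sup [set Lnorm (lebesgue_rV R n) p%:E
                   (fun x => (f (x + h *: unit_vector k) - f x)%:E)
            | h in `[0, delta]%classic].

Definition besov_partial (alpha p q : R) k f : \bar R :=
  ((\int[lebesgue_measure]_(t in `]0%R, +oo[)
      (((t `^ (- alpha))%:E * partial_modulus k f t p) `^ q * (t^-1)%:E))
    `^ q^-1)%E.

Definition besov (alpha p q : R) f : \bar R :=
  (\sum_(k < n) besov_partial alpha p q k f)%E.

Definition admissible K : set ('rV[R]_n -> R) :=
  [set f | [/\ smooth f, compactly_supported f & forall x, K x -> 1 <= f x]].

Definition besov_capacity (alpha p q : R) K : \bar R :=
  ereal_inf [set (besov alpha p q f `^ p)%E | f in admissible K].

End besov.

(* Main.v *)
From HB Require Import structures.
Require Import Defs.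
From mathcomp Require Import all_boot all_order all_algebra.
From mathcomp Require Import all_classical all_reals all_analysis.
From mathcomp Require Import measurable_realfun ring lra.
Import Order.TTheory GRing.Theory Num.Theory.
Import numFieldNormedType.Exports.

Local Open Scope classical_set_scope.
Local Open Scope ring_scope.
Set Implicit Arguments.
Unset Strict Implicit.
Unset Printing Implicit Defensive.

(** Write phi_k(t) for the modulus partial_modulus k f t p, |K| for the measure
    of K, and kappa = (2 |K|)^(1/p); the claimed limit is
    (n q^(-1/q) kappa)^p. The weight alpha t^(-alpha q - 1) dt concentrates at
    infinity on a logarithmic scale when alpha tends to 0, so that
    alpha^(1/q) times the k-th Besov seminorm of a fixed f tends to
    q^(-1/q) phi_k(oo), and a translation by a large vector separates the
    support of f from itself: phi_k(oo)^p = 2 ||f||_p^p for f nonnegative.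

    Upper bound. A nonnegative test function f, at least 1 on K, exists with
    ||f||_p^p as close to |K| as desired (exists_cutoff). For such an f,
    phi_k^p <= 2 ||f||_p^p (partial_modulus_nonneg) and phi_k(t) <= C t for
    t <= 1 (partial_modulus_lipschitz); integrating these two bounds
    (besov_partial_ub) gives the limit superior.

    Lower bound. The infimum is over all f, whatever alpha is, so a uniform
    argument is needed. As phi_k is nondecreasing, the k-th seminorm is at
    least c t^(-alpha) (alpha q)^(-1/q) as soon as c <= phi_k(t)
    (besov_partial_lb); it is thus enough to find a scale t at which
    phi_k(t) t^(-alpha) is almost kappa (modulus_dichotomy). If there is no t
    with phi_k(t) >= kappa t^alpha, then phi_k(t) <= kappa t^alpha for every t.
    Let v be a multiple of e_k longer than the diameter of K, and let A_s f(x)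
    be the mean of f over x, x + v, ..., x + (2^s - 1) v. Since the translates
    of K by multiples of v are disjoint, ||A_s g||_{L^p(K)} is at most
    2^(-s/p) ||g||_p (Lnorm_avg_le). The identity
    A_s f - A_{s+1} f = A_s (f - f(. + 2^s v)) / 2
    and the bound on phi_k then show, by telescoping up to s = oo where the
    compact support of f enters, that ||A_s f||_{L^p(K)} decays geometrically
    in s, uniformly in f and in small alpha (avg_decay). So the translates of f
    are on average small on K, in both directions v and -v, while f >= 1 on K.
    By convexity, and since K and its translate both contribute to the
    difference of f and a translate of f, phi_k(2^s |v|)^p is at least
    2 (|K|^(1/p) - eta)^p, where eta bounds ||A_s f||_{L^p(K)} and its analogue
    with -v in place of v (modulus_lower). The number s is fixed before
    alpha tends to 0, so the factor (2^s |v|)^(-alpha) is harmless. *)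

(** * Lebesgue measure on R^n: Borel sets, translations, bounded sets *)

Section measure_rV.
Variable R : realType.

Lemma ball_rVE n (x y : 'rV[R]_n) (e : R) : 0 < e ->
  ball x e y <-> forall i, `|x ord0 i - y ord0 i| < e.
Proof.
move=> e0; split; first by case=> _ + i => /(_ ord0 i).
by move=> h; split => // i j; rewrite [i]ord1; exact: h.
Qed.

Lemma measurable_ball_rV n (x : 'rV[R]_n) (e : R) : measurable (ball x e).
Proof.
have [e0|e0] := ltP 0 e; last first.
  rewrite (_ : ball x e = set0) // -subset0 => y [].
  by rewrite ltNge e0.
rewrite (_ : ball x e = \bigcap_(i in [set: 'I_n])
    (@rV_coor R n i @^-1` ball (x ord0 i) e)); last first.
  apply/seteqP; split => y /=.
    by move=> /(ball_rVE _ _ e0) h i _; exact: h.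
  by move=> h; apply/ball_rVE => // i; exact: h.
apply: fin_bigcap_measurable => // i _.
rewrite -[X in measurable X]setTI; apply: measurable_rV_coor => //.
exact: measurable_realfun.measurable_ball.
Qed.

(** The rational boxes contained in an open set cover it, so that the product
    sigma-algebra contains the open sets. *)
Lemma open_measurable_rV n (U : set 'rV[R]_n) : open U -> measurable U.
Proof.
move=> oU; pose B (z : 'rV[rat]_n * nat) : set 'rV[R]_n :=
  ball (map_mx ratr z.1 : 'rV[R]_n) (z.2.+1%:R^-1).
rewrite (_ : U = \bigcup_(z in [set z | B z `<=` U]) B z); last first.
  apply/seteqP; split => [x Ux|x [z /=]]; last exact.
  have /nbhs_ballP[e /= e0 xeU] : nbhs x U by exact: open_nbhs_nbhs.
  have [m] := near_infty_natSinv_lt (PosNum (divr_gt0 e0 (@ltr0Sn R 1))).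
  move=> _ /(_ m (leqnn _)) /= me.
  have m0 : 0 < m.+1%:R^-1 :> R by rewrite invr_gt0.
  have /choice[r Hr] (i : 'I_n) : exists r : rat,
      `|ratr r - x ord0 i| < m.+1%:R^-1.
    have [|r] := @rat_in_itvoo R (x ord0 i - m.+1%:R^-1) (x ord0 i + m.+1%:R^-1).
      by rewrite ltrD2l (lt_trans _ m0)// oppr_lt0.
    by rewrite in_itv /= => /andP[h1 h2]; exists r; rewrite distrC ltr_distlC h1.
  have Bx : B (\row_i r i, m) x by apply/ball_rVE => // i; rewrite !mxE.
  exists (\row_i r i, m) => //= y By; apply: xeU.
  rewrite (splitr e); apply: (@ball_triangle _ _ (map_mx ratr (\row_i r i) : 'rV[R]_n)).
    by apply: ball_sym; apply: le_ball Bx; exact: ltW.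
  by apply: le_ball By; exact: ltW.
rewrite bigcup_mkcond; apply: countable_bigcupT_measurable => [|z].
  exact: countableP.
by case: ifP => _ //; exact: measurable_ball_rV.
Qed.

Lemma continuous_measurable_rV n (f : 'rV[R]_n -> R) :
  continuous f -> measurable_fun setT f.
Proof.
move=> cf; apply: (measurability _ (RGenOpens.measurableE R)).
move=> _ [_ [a [b ->]] <-]; rewrite setTI; apply: open_measurable_rV.
by apply: open_comp => //; exact: interval_open.
Qed.

Lemma compact_measurable_rV n (K : set 'rV[R]_n) : compact K -> measurable K.
Proof.
move=> cK; rewrite -(setCK K); apply: measurableC; apply: open_measurable_rV.
by apply: closed_openC; apply: compact_closed => //; exact: norm_hausdorff.
Qed.

Lemma measurable_shift_rV n (v : 'rV[R]_n) :
  measurable_fun setT (fun x : 'rV[R]_n => x + v).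
Proof.
apply: measurable_fun_rV => i.
rewrite (_ : _ \o _ = (fun x => rV_coor i x + v ord0 i)); last first.
  by apply/funext => x; rewrite /rV_coor /= mxE.
by apply: measurable_funD; [exact: measurable_rV_coor|exact: measurable_cst].
Qed.

Lemma lebesgue_measure_shift (h : R) (A : set (measurableTypeR R)) :
  measurable A ->
  lebesgue_measure ((fun x => x + h) @^-1` A) = lebesgue_measure A.
Proof.
pose sh : measurableTypeR R -> measurableTypeR R := fun x => x + h.
have msh : measurable_fun setT sh by exact: measurable_funD.
pose m_sh := isMeasurableFun.Build _ _ _ _ _ msh.
pose f : {mfun _ >-> _} := HB.pack sh m_sh.
move=> mA.
apply/esym/(@lebesgue_measure_unique R (pushforward lebesgue_measure f)) => //.
move=> _ [[a b]] _ <-.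
have E : [set` `]a - h, b - h]] = sh @^-1` [set` `]a, b]].
  by apply/seteqP; split => x /=; rewrite /sh !in_itv /= ltrBlDr lerBrDr.
rewrite /pushforward; transitivity (lebesgue_measure [set` `]a - h, b - h]]).
  2: by congr lebesgue_measure.
rewrite !lebesgue_measure_itv /= !lte_fin ltrD2r; case: ifP => // _.
by congr EFin; lra.
Qed.

(** By induction on the dimension, slicing by the first coordinate. *)
Lemma lebesgue_rV_shift n (v : 'rV[R]_n) (A : set 'rV[R]_n) : measurable A ->
  lebesgue_rV R n ((fun x => x + v) @^-1` A) = lebesgue_rV R n A.
Proof.
elim: n v A => [|n IHn] v A mA.
  by congr (lebesgue_rV R 0 _); apply/seteqP; split => x /=;
    rewrite [x + v]thinmx0 [x]thinmx0.
rewrite /= /lebesgue_rV_succ /pushforward /product_measure1.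
set B := rV_cons (n:=n) @^-1` A.
have mB : measurable B.
  by rewrite -[X in measurable X]setTI; exact: measurable_rV_cons.
pose h := v ord0 ord0; pose w : 'rV[R]_n := \row_i v ord0 (lift ord0 i).
pose g x := lebesgue_rV R n (xsection B x).
have mg : measurable_fun setT g by exact: measurable_fun_xsection.
transitivity (\int[lebesgue_measure]_x g (x + h)%R)%E.
  apply: eq_integral => x _; rewrite /= /g.
  rewrite -[RHS](IHn w); last exact: measurable_xsection.
  congr (lebesgue_rV R n _); apply/seteqP; split => y /=;
    rewrite /xsection /= !inE /B /=.
    suff -> : rV_cons (x, y) + v = rV_cons (x + h, y + w) by [].
    apply/rowP => i; rewrite mxE; case: (unliftP ord0 i) => [j ->|->].
      by rewrite !rV_consS /= !mxE.
    by rewrite !rV_cons0.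
  suff -> : rV_cons (x, y) + v = rV_cons (x + h, y + w) by [].
  apply/rowP => i; rewrite mxE; case: (unliftP ord0 i) => [j ->|->].
    by rewrite !rV_consS /= !mxE.
  by rewrite !rV_cons0.
have msh : measurable_fun setT
    ((fun x => x + h) : measurableTypeR R -> measurableTypeR R).
  exact: measurable_funD.
have := @ge0_integral_pushforward _ _ _ _ R _ msh lebesgue_measure setT g.
rewrite preimage_setT => <- //.
apply: eq_measure_integral => C mC _; exact: lebesgue_measure_shift.
Qed.

Lemma ge0_integral_shift n (v : 'rV[R]_n) (f : 'rV[R]_n -> \bar R) :
  measurable_fun setT f -> (forall x, 0 <= f x)%E ->
  (\int[lebesgue_rV R n]_x f (x + v)%R = \int[lebesgue_rV R n]_x f x)%E.
Proof.
move=> mf f0.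
have := @ge0_integral_pushforward _ _ _ _ R _ (measurable_shift_rV v)
  (lebesgue_rV R n) setT f.
rewrite preimage_setT => <- //.
apply: eq_measure_integral => [|? C mC _]; first exact: measurable_shift_rV.
exact: lebesgue_rV_shift.
Qed.

Lemma lebesgue_rV_bounded n (A : set 'rV[R]_n) (M : R) : measurable A ->
  (forall x, A x -> forall i, `|x ord0 i| <= M) -> (lebesgue_rV R n A < +oo)%E.
Proof.
move=> mA AM; have [M0|M0] := ltP M 0.
  case: n => [|n] in A mA AM *.
    by rewrite (le_lt_trans (probability_le1 _ _))// ltry.
  rewrite (_ : A = set0) ?measure0// -subset0 => x /AM /(_ ord0).
  by rewrite leNgt (lt_le_trans M0).
have h := @lebesgue_rV_box R n (const_mx (- M)) (const_mx M).
pose D : R := \prod_(i < n)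
  ((const_mx M : 'rV[R]_n) ord0 i - (const_mx (- M) : 'rV[R]_n) ord0 i).
rewrite (le_lt_trans _ (ltry D))// /D.
rewrite -h; last by move=> i; rewrite !mxE; lra.
apply: le_measure; rewrite ?inE//.
  rewrite [X in measurable X](_ : _ = \bigcap_(i in [set: 'I_n])
      (@rV_coor R n i @^-1` `[- M, M])); last first.
    apply/seteqP; split => x /= h' i => [_|].
      by have := h' i; rewrite !mxE /rV_coor /= in_itv.
    by have := h' i I; rewrite !mxE /rV_coor /= in_itv.
  apply: fin_bigcap_measurable => // i _.
  rewrite -[X in measurable X]setTI.
  by apply: measurable_rV_coor => //; exact: measurable_itv.
by move=> x /AM /= Ax i; rewrite !mxE -ler_norml.
Qed.
End measure_rV.

(** * Integrals of powers, and bounds on the Besov seminorms *)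

Section integrals.
Variable R : realType.
Local Notation mu := (@lebesgue_measure R).

(** Monotonicity of the integral of nonnegative functions needs no
    measurability, the integral being a supremum over simple functions. *)
Lemma ge0_le_integral_gen d (T : measurableType d)
    (m : {measure set T -> \bar R}) (D D' : set T) (f g : T -> \bar R) :
  (forall x, D x -> 0 <= f x)%E -> (forall x, D' x -> 0 <= g x)%E ->
  D `<=` D' -> (forall x, D x -> f x <= g x)%E ->
  (\int[m]_(x in D) f x <= \int[m]_(x in D') g x)%E.
Proof.
move=> f0 g0 DD' fg; rewrite !ge0_integralE //.
apply: ereal_sup_le => _ [h /= hf <-]; exists h => // x.
apply: (le_trans (hf x)); rewrite !patchE; case: ifPn => [xD|xD].
  have Dx : D x by rewrite inE in xD.
  by rewrite mem_set ?fg //; exact: DD'.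
by case: ifPn => // xD'; apply: g0; rewrite inE in xD'.
Qed.

Lemma is_derive1_Z_powR (k e x : R) : 0 < x ->
  is_derive x 1 (fun t : R => k * t `^ e) (k * (e * x `^ (e - 1))).
Proof. by move=> x0; exact: (is_deriveZ k (is_derive1_powR e x0)). Qed.

Lemma powR_continuous_gt0 (e x : R) : 0 < x ->
  {for x, continuous (@powR R ^~ e)}.
Proof.
move=> x0; apply: differentiable_continuous; apply/derivable1_diffP.
by have [] := is_derive1_powR e x0.
Qed.

Lemma integral_powR_infty (b T : R) : 0 < b -> 0 < T ->
  (\int[mu]_(t in `[T, +oo[) (t `^ (- b - 1))%:E = (T `^ (- b) / b)%:E)%E.
Proof.
move=> b0 T0; pose F (t : R) := - b^-1 * t `^ (- b).
have dF (x : R) : 0 < x -> is_derive x 1 F (x `^ (- b - 1)).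
  move=> x0; have := is_derive1_Z_powR (- b^-1) (- b) x0.
  by rewrite mulrA mulrNN mulVf ?gt_eqF // mul1r.
have cpow := powR_continuous_gt0.
rewrite (@ge0_continuous_FTC2y _ _ F _ 0).
- by rewrite /F -EFinB mulNr opprK add0r mulrC.
- by move=> x _; exact: powR_ge0.
- apply/continuous_within_itvcyP; split.
    by move=> x; rewrite in_itv /= andbT => Tx; apply: cpow; exact: lt_trans Tx.
  by apply: cvg_at_right_filter; exact: cpow.
- rewrite /F -[X in _ --> X](mulr0 (- b^-1)); apply: cvgMr.
  apply/cvgrPdist_lt => e e0; near=> t.
  rewrite sub0r normrN ger0_norm ?powR_ge0 // powRN.
  have t0 : 0 < t by near: t; apply: nbhs_pinfty_gt; rewrite num_real.
  rewrite invf_plt ?posrE ?powR_gt0 //.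
  have -> : e^-1 = (e^-1 `^ b^-1) `^ b.
    by rewrite -powRrM mulVf ?gt_eqF // powRr1 ?invr_ge0 ?ltW.
  have te : e^-1 `^ b^-1 < t.
    by near: t; apply: nbhs_pinfty_gt; rewrite num_real.
  by apply: gt0_ltr_powR => //; rewrite nnegrE ?powR_ge0 ?ltW.
- by move=> x Tx; have [] := dF x (lt_trans T0 Tx).
- apply: cvg_at_right_filter; apply: differentiable_continuous.
  by apply/derivable1_diffP; have [] := dF _ T0.
- move=> x; rewrite in_itv /= andbT => Tx; rewrite derive1E.
  by have [] := dF x (lt_trans T0 Tx).
Unshelve. all: by end_near. Qed.

Lemma integral_powR_01 (c : R) : 0 < c ->
  (\int[mu]_(t in `]0%R, 1%R]) (t `^ (c - 1))%:E <= (c^-1)%:E)%E.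
Proof.
move=> c0; pose F (t : R) := c^-1 * t `^ c.
have dF (x : R) : 0 < x -> is_derive x 1 F (x `^ (c - 1)).
  move=> x0; have := is_derive1_Z_powR c^-1 c x0.
  by rewrite mulrA mulVf ?gt_eqF // mul1r.
have cpow := powR_continuous_gt0.
pose A (i : nat) : set (measurableTypeR R) := `[i.+2%:R^-1, 1%R]%classic.
have -> : `]0%R, 1%R]%classic = \bigcup_i A i.
  apply/seteqP; split => x /=.
    rewrite in_itv /= => /andP[x0 x1].
    have [m _ /(_ m (leqnn _)) mx] := near_infty_natSinv_lt (PosNum x0).
    exists m => //; rewrite /A /= in_itv /= x1 andbT ltW // (le_lt_trans _ mx) //.
    by rewrite lef_pV2 ?posrE // ler_nat.
  move=> [i _]; rewrite /A /= !in_itv /= => /andP[x0 ->]; rewrite andbT.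
  by rewrite (lt_le_trans _ x0).
have mA i : measurable (A i) by exact: measurable_itv.
have mf : measurable_fun setT (fun t : measurableTypeR R => (t `^ (c - 1))%:E).
  by apply/measurable_EFinP; exact: measurable_powR.
have h := @ge0_nondecreasing_set_cvg_integral _ _ R A
  (fun t => (t `^ (c - 1))%:E) mu.
rewrite -(cvg_lim _ (h _ _ _ _)) //; first last.
- by move=> i x _; rewrite lee_fin powR_ge0.
- by move=> i; exact: measurable_funS mf.
- move=> i j ij; rewrite subsetEset => x; rewrite /A /= !in_itv /= => /andP[+ ->].
  rewrite andbT; apply: le_trans.
  by rewrite lef_pV2 ?posrE // ler_nat.
apply: lime_le.
  by apply/cvg_ex; eexists; apply: h => //;
   [move=> i j ij; rewrite subsetEset => x; rewrite /A /= !in_itv /= => /andP[+ ->];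
    rewrite andbT; apply: le_trans; rewrite lef_pV2 ?posrE // ler_nat
   |move=> i; exact: measurable_funS mf
   |by move=> i x _; rewrite lee_fin powR_ge0].
apply: nearW => i.
have i1 : i.+2%:R^-1 < 1 :> R by rewrite invf_lt1 // ltr1n.
have i0 : 0 < i.+2%:R^-1 :> R by rewrite invr_gt0.
have cF x : 0 < x -> {for x, continuous F}.
  by move=> x0; apply: differentiable_continuous; apply/derivable1_diffP;
    have [] := dF _ x0.
rewrite (@continuous_FTC2 _ _ F) //.
- rewrite /F powR1 -EFinB lee_fin mulr1 lerBlDr lerDl.
  by rewrite mulr_ge0 ?powR_ge0 // invr_ge0 ltW.
- apply: continuous_in_subspaceT => x; rewrite inE /= in_itv /= => /andP[ix _].
  by apply: cpow; exact: lt_le_trans ix.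
- split.
  + by move=> x; rewrite in_itv /= => /andP[ix _]; have [] := dF _ (lt_trans i0 ix).
  + by apply: cvg_at_right_filter; exact: cF.
  + by apply: cvg_at_left_filter; exact: cF.
- move=> x; rewrite in_itv /= => /andP[ix _]; rewrite derive1E.
  by have [] := dF _ (lt_trans i0 ix).
Qed.

End integrals.

Section besov_bounds.
Variables (R : realType) (n : nat).
Implicit Types (alpha p q : R) (k : 'I_n) (f : 'rV[R]_n -> R).

Lemma partial_modulus_ge0 k f (t p : R) : 0 <= t ->
  (0 <= partial_modulus k f t p)%E.
Proof.
move=> t0; apply: (@le_trans _ _ (Lnorm (lebesgue_rV R n) p%:E
  (fun x => (f (x + 0 *: unit_vector R k) - f x)%:E))) => //.
  exact: Lnorm_ge0.
by apply: ereal_sup_ubound; exists 0 => //=; rewrite in_itv /= lexx.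
Qed.

Lemma le_partial_modulus k f (s t p : R) : s <= t ->
  (partial_modulus k f s p <= partial_modulus k f t p)%E.
Proof.
move=> st; apply: ereal_sup_le => _ [h /= + <-]; rewrite in_itv /= => /andP[h0 hs].
by exists h => //=; rewrite in_itv /= h0 (le_trans hs).
Qed.

Lemma besov_partial_lb alpha p q k f (c T : R) :
  0 < alpha -> 1 <= q -> 0 <= c -> 0 < T ->
  (c%:E <= partial_modulus k f T p)%E ->
  ((((c * T `^ (- alpha)) `^ q / (alpha * q)) `^ q^-1)%:E
    <= besov_partial alpha p q k f)%E.
Proof.
move=> a0 q1 c0 T0 cT; have q0 : 0 < q by rewrite (lt_le_trans _ q1).
have aq0 : 0 < alpha * q by rewrite mulr_gt0.
rewrite /besov_partial -poweR_EFin; apply: gt0_ler_poweR.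
- by rewrite invr_ge0 ltW.
- by rewrite in_itv /= leey andbT lee_fin divr_ge0 ?powR_ge0 // ltW.
- rewrite in_itv /= leey andbT; apply: integral_ge0 => t; rewrite /= in_itv /= andbT => t0.
  by rewrite mule_ge0 ?poweR_ge0 // lee_fin invr_ge0 ltW.
apply: (@le_trans _ _ (\int[lebesgue_measure]_(t in `[T, +oo[)
   ((c `^ q)%:E * (t `^ (- (alpha * q) - 1))%:E))%E).
  rewrite ge0_integralZl_EFin //; last 3 first.
  - by move=> t _; rewrite lee_fin powR_ge0.
  - by apply/measurable_EFinP; apply: measurable_funTS; exact: measurable_powR.
  - exact: powR_ge0.
  rewrite integral_powR_infty // -EFinM lee_fin powRM ?powR_ge0 //.
  by rewrite -powRrM mulNr mulrA.
apply: ge0_le_integral_gen.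
- by move=> t _; rewrite -EFinM lee_fin mulr_ge0 ?powR_ge0.
- move=> t; rewrite /= in_itv /= andbT => t0.
  by rewrite mule_ge0 ?poweR_ge0 // lee_fin invr_ge0 ltW.
- by move=> t /=; rewrite !in_itv /= !andbT; exact: lt_le_trans.
move=> t; rewrite /= in_itv /= andbT => Tt.
have t0 : 0 < t by exact: lt_le_trans Tt.
rewrite poweRM ?(partial_modulus_ge0 _ _ _ (ltW t0)) ?lee_fin ?powR_ge0 //.
rewrite poweR_EFin -powRrM mulNr powRB; last by rewrite (gt_eqF t0) implybT.
rewrite powRr1 ?(ltW t0) // EFinM muleA; apply: lee_wpmul2r.
  by rewrite lee_fin invr_ge0 ltW.
rewrite muleC; apply: lee_wpmul2l; first by rewrite lee_fin powR_ge0.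
rewrite -poweR_EFin; apply: gt0_ler_poweR; rewrite ?in_itv /= ?leey ?andbT ?lee_fin ?(ltW q0) //.
  by rewrite partial_modulus_ge0 // ltW.
by apply: (le_trans cT); exact: le_partial_modulus.
Qed.

Lemma besov_partial_ub alpha p q k f (C W : R) :
  0 < alpha -> alpha <= 2^-1 -> 1 <= q -> 0 <= C -> 0 <= W ->
  (forall t : R, 0 < t <= 1 -> (partial_modulus k f t p <= (C * t)%:E)%E) ->
  (forall t : R, 0 < t -> (partial_modulus k f t p <= W%:E)%E) ->
  (besov_partial alpha p q k f <=
   ((2 * C `^ q + W `^ q / (alpha * q)) `^ q^-1)%:E)%E.
Proof.
move=> a0 ah q1 C0 W0 hC hW; have q0 : 0 < q by rewrite (lt_le_trans _ q1).
have aq0 : 0 < alpha * q by rewrite mulr_gt0.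
pose c := (1 - alpha) * q.
have c0 : 2^-1 <= c by rewrite /c; nra.
have cgt0 : 0 < c by rewrite (lt_le_trans _ c0).
rewrite /besov_partial -poweR_EFin; apply: gt0_ler_poweR.
- by rewrite invr_ge0 ltW.
- rewrite in_itv /= leey andbT; apply: integral_ge0 => t; rewrite /= in_itv /= andbT => t0.
  by rewrite mule_ge0 ?poweR_ge0 // lee_fin invr_ge0 ltW.
- rewrite in_itv /= leey andbT lee_fin addr_ge0 ?mulr_ge0 ?powR_ge0 //.
  by rewrite invr_ge0 ltW.
(* majorants of the integrand on ]0, 1] and on [1, +oo[ *)
pose g1 (t : R) := ((C `^ q)%:E * (t `^ (c - 1))%:E)%E.
pose g2 (t : R) := ((W `^ q)%:E * (t `^ (- (alpha * q) - 1))%:E)%E.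
have g10 t : (0 <= g1 t)%E by rewrite /g1 -EFinM lee_fin mulr_ge0 ?powR_ge0.
have g20 t : (0 <= g2 t)%E by rewrite /g2 -EFinM lee_fin mulr_ge0 ?powR_ge0.
have mg1 : measurable_fun [set: R] g1.
  apply: emeasurable_funM => //; apply/measurable_EFinP; exact: measurable_powR.
have mg2 : measurable_fun [set: R] g2.
  apply: emeasurable_funM => //; apply/measurable_EFinP; exact: measurable_powR.
pose g t := ((g1 \_ `]0%R, 1%R]) t + (g2 \_ `[1%R, +oo[) t)%E.
apply: (@le_trans _ _ (\int[lebesgue_measure]_t g t)%E).
  apply: ge0_le_integral_gen => //.
  - move=> t; rewrite /= in_itv /= andbT => t0.
    by rewrite mule_ge0 ?poweR_ge0 // lee_fin invr_ge0 ltW.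
  - by move=> t _; rewrite adde_ge0 ?erestrict_ge0.
  move=> t; rewrite /= in_itv /= andbT => t0.
  have key D : (partial_modulus k f t p <= D%:E)%E -> 0 <= D ->
    (((t `^ (- alpha))%:E * partial_modulus k f t p) `^ q * (t^-1)%:E <=
     (D `^ q * t `^ (- (alpha * q) - 1))%:E)%E.
    move=> hD D0.
    rewrite poweRM ?(partial_modulus_ge0 _ _ _ (ltW t0)) ?lee_fin ?powR_ge0 //.
    rewrite poweR_EFin -powRrM mulNr powRB; last by rewrite (gt_eqF t0) implybT.
    rewrite powRr1 ?(ltW t0) // mulrA EFinM; apply: lee_wpmul2r.
      by rewrite lee_fin invr_ge0 ltW.
    rewrite EFinM [leRHS]muleC; apply: lee_wpmul2l; first by rewrite lee_fin powR_ge0.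
    rewrite -poweR_EFin; apply: gt0_ler_poweR; rewrite ?in_itv /= ?leey ?andbT ?lee_fin ?(ltW q0) //.
    by rewrite partial_modulus_ge0 // ltW.
  have [t1|t1] := leP t 1.
    apply: (le_trans (key _ (hC t _) _)); rewrite ?t0 ?t1 ?mulr_ge0 ?(ltW t0) //.
    apply: (@le_trans _ _ (g1 t)); last first.
      rewrite /g [X in (X + _)%E]patchE mem_set /= ?in_itv /= ?t0 ?t1 //.
      by rewrite leeDl // erestrict_ge0.
    rewrite /g1 -EFinM lee_fin powRM ?(ltW t0) // -mulrA -powRD ?(gt_eqF t0) ?implybT //.
    by rewrite (_ : q + _ = c - 1) // /c; ring.
  apply: (le_trans (key _ (hW t _) _)) => //.
  rewrite /g [X in (_ + X)%E]patchE mem_set /= ?in_itv /= ?(ltW t1) //.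
  by rewrite EFinM leeDr // erestrict_ge0.
rewrite ge0_integralD //; last 4 first.
- by move=> t _; rewrite erestrict_ge0.
- by apply/(measurable_restrictT _ _).1 => //; exact: measurable_funS mg1.
- by move=> t _; rewrite erestrict_ge0.
- by apply/(measurable_restrictT _ _).1 => //; exact: measurable_funS mg2.
rewrite -!integral_mkcond EFinD leeD //.
  rewrite ge0_integralZl_EFin //; last 3 first.
  - by move=> t _; rewrite lee_fin powR_ge0.
  - by apply/measurable_EFinP; apply: measurable_funTS; exact: measurable_powR.
  - exact: powR_ge0.
  rewrite mulrC EFinM; apply: lee_wpmul2l; first by rewrite lee_fin powR_ge0.
  apply: (le_trans (integral_powR_01 cgt0)).
  by rewrite lee_fin invf_ple ?posrE.
rewrite ge0_integralZl_EFin //; last 3 first.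
- by move=> t _; rewrite lee_fin powR_ge0.
- by apply/measurable_EFinP; apply: measurable_funTS; exact: measurable_powR.
- exact: powR_ge0.
by rewrite integral_powR_infty // powR1 -EFinM mul1r.
Qed.

End besov_bounds.

(** * Averages over separated translates *)

Section averages.
Variables (R : realType) (n : nat).
Implicit Types (f g : 'rV[R]_n -> R) (v x : 'rV[R]_n).

(** The mean of f over the 2 ^ s points x, x + v, ..., x + (2 ^ s - 1) v. *)
Definition avg (s : nat) v f x : R :=
  (2 ^+ s)^-1 * \sum_(i < 2 ^ s) f (x + i%:R *: v).

Lemma avg0 v f x : avg 0 v f x = f x.
Proof. by rewrite /avg expr0 invr1 mul1r big_ord1 scale0r addr0. Qed.

Lemma avgS s v f x :
  avg s.+1 v f x = 2^-1 * (avg s v f x + avg s v f (x + (2 ^ s)%:R *: v)).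
Proof.
rewrite /avg -mulrDr mulrA -invfM -exprS; congr (_ * _).
have -> : (2 ^ s.+1 = 2 ^ s + 2 ^ s)%N by rewrite expnS mul2n addnn.
rewrite big_split_ord /=; congr (_ + _); apply: eq_bigr => i _.
by rewrite natrD scalerDl addrA.
Qed.

Lemma avgB s v f g x :
  avg s v (fun y => f y - g y) x = avg s v f x - avg s v g x.
Proof. by rewrite /avg -mulrBr sumrB. Qed.

Lemma avg_cst s v (c : R) x : avg s v (fun=> c) x = c.
Proof.
rewrite /avg sumr_const card_ord -[c *+ _]mulr_natl mulrA natrX mulVf ?mul1r // expf_neq0.
Qed.

Lemma avg_telescope s v f x : avg s v f x =
  avg s.+1 v f x + 2^-1 * avg s v (fun y => f y - f (y + (2 ^ s)%:R *: v)) x.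
Proof.
rewrite avgS avgB -mulrDr.
have -> : avg s v f (x + (2 ^ s)%:R *: v) =
    avg s v (fun y => f (y + (2 ^ s)%:R *: v)) x.
  by congr (_ * _); apply: eq_bigr => i _; rewrite addrAC.
by field.
Qed.

Lemma powR_midpoint (p a b : R) : 1 <= p -> 0 <= a -> 0 <= b ->
  (2^-1 * (a + b)) `^ p <= 2^-1 * (a `^ p + b `^ p).
Proof.
move=> p1 a0 b0.
have h0 : 0 <= (2^-1 : R) by rewrite invr_ge0.
have h1 : (2^-1 : R) <= 1 by rewrite invf_le1 // ler1n.
have half : 1 - 2^-1 = 2^-1 :> R by field.
have H := convex_powR p1 (Itv01 h0 h1) (x := a) (y := b).
move: H; rewrite !inE /= !in_itv /= !andbT => /(_ a0 b0) H.
rewrite convRE [X in X `^ _ <= _]convRE in H.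
by move: H; rewrite /= /unstable.onem !half -!mulrDr.
Qed.

(** Jensen's inequality for the dyadic averages, by repeated halving. *)
Lemma powR_avg (p : R) s v f x : 1 <= p ->
  `|avg s v f x| `^ p <= avg s v (fun y => `|f y| `^ p) x.
Proof.
move=> p1; have p0 : 0 <= p by rewrite (le_trans _ p1).
elim: s x => [|s IHs] x; first by rewrite !avg0.
rewrite !avgS normrM ger0_norm ?invr_ge0 //.
apply: (@le_trans _ _ ((2^-1 * (`|avg s v f x| +
    `|avg s v f (x + (2 ^ s)%:R *: v)|)) `^ p)).
  apply: ge0_ler_powR => //; rewrite ?nnegrE ?mulr_ge0 ?addr_ge0 ?invr_ge0 //.
  by apply: ler_wpM2l; rewrite ?invr_ge0 // ler_normD.
apply: (le_trans (powR_midpoint p1 _ _)) => //.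
by apply: ler_wpM2l; rewrite ?invr_ge0 // lerD.
Qed.

Lemma measurable_comp_shift f v : measurable_fun setT f ->
  measurable_fun setT (fun x => f (x + v)).
Proof. by move=> mf; exact: (measurableT_comp mf (measurable_shift_rV v)). Qed.

Lemma measurable_avg s v f : measurable_fun setT f ->
  measurable_fun setT (avg s v f).
Proof.
move=> mf; apply: measurable_funM => //; apply: measurable_sum => i.
exact: measurable_comp_shift.
Qed.

Lemma measurable_powR_norm (p : R) f : measurable_fun setT f ->
  measurable_fun setT (fun x => `|f x| `^ p).
Proof.
move=> mf; apply: (measurableT_comp (measurable_powR p)).
exact: measurableT_comp.
Qed.

End averages.

Section translates.
Variables (R : realType) (n : nat) (p : R).
Hypothesis p1 : 1 <= p.
Local Notation mu := (lebesgue_rV R n).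
Local Notation "''N' f" := (Lnorm mu p%:E (EFin \o f)) (at level 8, f at level 2).
Implicit Types (f g : 'rV[R]_n -> R) (v w x : 'rV[R]_n).

Let p0 : 0 < p. Proof. by rewrite (lt_le_trans _ p1). Qed.

(** All the positive multiples of v translate K off itself. *)
Definition separated (K : set 'rV[R]_n) v :=
  forall m : nat, (0 < m)%N -> forall x, K x -> ~ K (x + m%:R *: v).

Lemma separatedN (K : set 'rV[R]_n) v : separated K v -> separated K (- v).
Proof.
move=> h m m0 x Kx Kxm; apply: (h m m0 _ Kxm).
by rewrite scalerN subrK.
Qed.

Lemma Lnorm_powE f : ('N f `^ p = \int[mu]_x (`|f x| `^ p)%:E)%E.
Proof.
by rewrite poweR_Lnorm ?gt_eqF //; apply: eq_integral => x _ /=.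
Qed.

Lemma poweR_pK (a : \bar R) : (0 <= a)%E -> ((a `^ p) `^ p^-1)%E = a.
Proof. by move=> a0; rewrite -poweRrM divff ?gt_eqF // poweRe1. Qed.

Lemma le_poweR_inv (a b : \bar R) : (0 <= a)%E -> (0 <= b)%E ->
  (a `^ p <= b `^ p)%E -> (a <= b)%E.
Proof.
move=> a0 b0 ab; rewrite -(poweR_pK a0) -(poweR_pK b0).
by apply: gt0_ler_poweR => //;
  rewrite ?invr_ge0 ?(ltW p0) // in_itv /= leey andbT poweR_ge0.
Qed.

Lemma ge0_int_shift v g : measurable_fun setT g -> (forall x, 0 <= g x) ->
  (\int[mu]_x (g (x + v)%R)%:E = \int[mu]_x (g x)%:E)%E.
Proof.
move=> mg g0; apply: (ge0_integral_shift v (f := EFin \o g)).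
  exact/measurable_EFinP.
by move=> x; rewrite lee_fin.
Qed.

Lemma Lnorm_shift v f : measurable_fun setT f ->
  'N (fun x => f (x + v)) = 'N f.
Proof.
move=> mf; rewrite -[LHS]poweR_pK ?Lnorm_ge0 // -[RHS]poweR_pK ?Lnorm_ge0 //.
rewrite !Lnorm_powE.
rewrite (ge0_int_shift v (g := fun x => `|f x| `^ p)) //.
exact: measurable_powR_norm.
Qed.

(** Disjoint translates of K carry at most the total mass of g. *)
Lemma sum_int_translates (K : set 'rV[R]_n) v g (N : nat) :
  measurable K -> separated K v ->
  measurable_fun setT g -> (forall x, 0 <= g x) ->
  (\sum_(i < N) \int[mu]_x (\1_K x * g (x + i%:R *: v)%R)%:E
    <= \int[mu]_x (g x)%:E)%E.
Proof.
move=> mK sK mg g0.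
pose G (i : nat) x : R := \1_K (x - i%:R *: v) * g x.
have mG i : measurable_fun setT (G i).
  apply: measurable_funM => //.
  exact: (measurable_comp_shift (- (i%:R *: v)) (measurable_indic mK)).
have G0 i x : 0 <= G i x by rewrite mulr_ge0.
rewrite (eq_bigr (fun i : 'I_N => (\int[mu]_x (G i x)%:E)%E)); last first.
  move=> i _; rewrite -(ge0_int_shift (i%:R *: v) (mG i) (G0 i)).
  by apply: eq_integral => x _; rewrite /G addrK.
rewrite -ge0_integral_sum //; last 2 first.
- by move=> i; apply/measurable_EFinP; exact: mG.
- by move=> i x _; rewrite lee_fin.
apply: ge0_le_integral => //.
- by move=> x _; rewrite sume_ge0 // => i _; rewrite lee_fin.
- by apply: emeasurable_sum => i; apply/measurable_EFinP; exact: mG.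
- exact/measurable_EFinP.
move=> x _; rewrite sumEFin lee_fin /G -mulr_suml.
rewrite -[leRHS]mul1r ler_wpM2r //.
have [[i Ki]|no] := pselect (exists i : 'I_N, K (x - (i : nat)%:R *: v)).
  rewrite (bigD1 i) //= big1 ?addr0; last first.
    move=> j ij; rewrite indicE memNset // => Kj.
    have [lij|lji|/val_inj/eqP eij] := ltngtP i j.
    - apply: (sK (j - i)%N _ _ Kj); first by rewrite subn_gt0.
      by rewrite natrB ?(ltnW lij) // scalerBl addrA subrK.
    - apply: (sK (i - j)%N _ _ Ki); first by rewrite subn_gt0.
      by rewrite natrB ?(ltnW lji) // scalerBl addrA subrK.
    - by rewrite eq_sym eij in ij.
  by rewrite indicE; case: (_ \in _).
rewrite big1 // => i _; rewrite indicE memNset // => Ki; apply: no; by exists i.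
Qed.

(** Averaging over separated translates contracts by 2 ^ (- s / p). *)
Lemma Lnorm_avg_le (K : set 'rV[R]_n) v f s :
  measurable K -> separated K v -> measurable_fun setT f ->
  ('N (fun x => \1_K x * avg s v f x)%R
    <= ((2 ^+ s) `^ (- p^-1))%:E * 'N f)%E.
Proof.
move=> mK sK mf; apply: le_poweR_inv; rewrite ?Lnorm_ge0 //.
  by rewrite mule_ge0 ?Lnorm_ge0 ?lee_fin ?powR_ge0.
rewrite poweRM ?Lnorm_ge0 ?lee_fin ?powR_ge0 // !Lnorm_powE poweR_EFin -powRrM mulNr.
rewrite mulVf ?gt_eqF // powR_inv1 ?exprn_ge0 //.
have mfp := measurable_powR_norm p mf.
apply: (@le_trans _ _ (\int[mu]_x
    \sum_(i < 2 ^ s) ((2 ^+ s)^-1 * (\1_K x * `|f (x + i%:R *: v)%R| `^ p))%:E)%E).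
  apply: ge0_le_integral => //.
  - apply/measurable_EFinP; apply: measurable_powR_norm.
    by apply: measurable_funM; [exact: measurable_indic|exact: measurable_avg].
  - apply: emeasurable_sum => i; apply/measurable_EFinP.
    apply: measurable_funM => //; apply: measurable_funM.
      exact: measurable_indic.
    exact: (measurable_comp_shift (i%:R *: v) mfp).
  - move=> x _ /=; rewrite sumEFin lee_fin -!mulr_sumr [leRHS]mulrCA indicE.
    case: (_ \in _); rewrite ?mulr1n ?mulr0n; last first.
      by rewrite !mul0r normr0 powR0 ?gt_eqF.
    by rewrite !mul1r; exact: powR_avg.
rewrite ge0_integral_sum //; last first.
  move=> i; apply/measurable_EFinP.
  apply: measurable_funM => //; apply: measurable_funM.
    exact: measurable_indic.
  exact: (measurable_comp_shift (i%:R *: v) mfp).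
rewrite (eq_bigr (fun i : 'I_(2 ^ s) => ((2 ^+ s)^-1)%:E *
   \int[mu]_x (\1_K x * `|f (x + i%:R *: v)%R| `^ p)%:E)%E); last first.
  move=> i _; rewrite -ge0_integralZl_EFin //.
  apply/measurable_EFinP; apply: measurable_funM; first exact: measurable_indic.
  exact: (measurable_comp_shift (i%:R *: v) mfp).
rewrite -ge0_sume_distrr; last first.
  move=> i _; apply: integral_ge0 => x _.
  by rewrite lee_fin mulr_ge0 ?powR_ge0.
apply: lee_wpmul2l; first by rewrite lee_fin invr_ge0 exprn_ge0.
exact: (sum_int_translates (g := fun x => `|f x| `^ p)).
Qed.

End translates.

(** * Decay of the averages, and a lower bound on the moduli of continuity *)

Section lower_bound.
Variables (R : realType) (n : nat) (p : R).
Hypothesis p1 : 1 <= p.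
Local Notation mu := (lebesgue_rV R n).
Local Notation "''N' f" := (Lnorm mu p%:E (EFin \o f)) (at level 8, f at level 2).
Implicit Types (f g : 'rV[R]_n -> R) (v w x : 'rV[R]_n) (K : set 'rV[R]_n).

Let p0 : 0 < p. Proof. by rewrite (lt_le_trans _ p1). Qed.

Lemma le_Lnorm f g : (forall x, `|f x| <= `|g x|) -> ('N f <= 'N g)%E.
Proof.
move=> fg; apply: (le_poweR_inv p1); rewrite ?Lnorm_ge0 // !Lnorm_powE //.
apply: ge0_le_integral_gen => // x _; rewrite lee_fin.
by apply: ge0_ler_powR => //; rewrite ?nnegrE // ltW.
Qed.

Lemma two_powR (e : R) (s : nat) : (2 ^+ s) `^ e = (2 `^ e) ^+ s.
Proof.
by rewrite -powR_mulrn // -powRrM mulrC powRrM powR_mulrn ?powR_ge0.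
Qed.

Lemma two_powRN_lt1 (e : R) : 0 < e -> 2 `^ (- e) < 1.
Proof.
move=> e0; rewrite powRN invf_lt1 ?powR_gt0 //.
apply: (@le_lt_trans _ _ (1 `^ e)); first by rewrite powR1.
by apply: gt0_ltr_powR => //; rewrite ?nnegrE // ltr1n.
Qed.

(** If the translation differences of f grow at most like a small power of the
    dyadic step, then the dyadic averages of f decay geometrically on K. *)
Lemma avg_decay K v f (B alpha : R) (s : nat) :
  measurable K -> separated K v -> measurable_fun setT f ->
  ('N f < +oo)%E -> 0 <= B -> alpha <= (2 * p)^-1 ->
  (forall j : nat, 'N (fun x => f (x + (2 ^ j)%:R *: v) - f x)%R <=
     (B * (2 ^+ j) `^ alpha)%:E)%E ->
  ('N (fun x => \1_K x * avg s v f x)%R <=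
    (B * (2 `^ (- (2 * p)^-1)) ^+ s / (1 - 2 `^ (- (2 * p)^-1)))%:E)%E.
Proof.
move=> mK sK mf fin B0 ha hB; set th := 2 `^ _.
have p20 : 0 < (2 * p)^-1 by rewrite invr_gt0 mulr_gt0.
have th1 : th < 1 by exact: two_powRN_lt1.
have th0 : 0 <= th by exact: powR_ge0.
pose a s := 'N (fun x => \1_K x * avg s v f x).
have step j : (a j <= a j.+1 + (B * th ^+ j)%:E)%E.
  (* A_j f = A_{j+1} f + A_j g *)
  pose g y := 2^-1 * (f y - f (y + (2 ^ j)%:R *: v)).
  have mg : measurable_fun setT g.
    apply: measurable_funM => //; apply: measurable_funB => //.
    exact: measurable_comp_shift.
  have -> : a j = 'N ((fun x => \1_K x * avg j.+1 v f x) \+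
                      (fun x => \1_K x * avg j v g x))%R.
    congr (Lnorm _ _ _); apply/funext => x /=; congr EFin.
    rewrite -mulrDr avg_telescope; congr (_ * (_ + _)).
    by rewrite /avg mulrCA mulr_sumr.
  apply: (le_trans (minkowski_EFin _ _ _ _)) => //.
  - by apply: measurable_funM; [exact: measurable_indic|exact: measurable_avg].
  - by apply: measurable_funM; [exact: measurable_indic|exact: measurable_avg].
  apply: leeD2l; apply: (le_trans (Lnorm_avg_le p1 _ mK sK mg)).
  apply: (@le_trans _ _ (((2 ^+ j) `^ (- p^-1))%:E *
      (B * (2 ^+ j) `^ alpha)%:E)%E).
    apply: lee_wpmul2l; first by rewrite lee_fin powR_ge0.
    apply: le_trans (hB j); apply: le_Lnorm => x.
    rewrite normrM distrC ger0_norm ?invr_ge0 // ler_piMl //.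
    by rewrite invf_le1 // ler1n.
  rewrite -EFinM lee_fin mulrCA; apply: ler_wpM2l => //.
  rewrite -powRD; last by rewrite expf_neq0 // implybT.
  rewrite -[leRHS]two_powR; apply: ler_powR; first by rewrite exprn_ege1 // ler1n.
  have -> : (2 * p)^-1 = p^-1 / 2 by rewrite invfM mulrC.
  by move: ha; rewrite (_ : (2 * p)^-1 = p^-1 / 2) ?invfM 1?mulrC //; lra.
(* finite telescoping; a (s + m) then tends to 0 because f is in L^p *)
have ind m : (a s <= a (s + m)%N +
    (B * (th ^+ s - th ^+ (s + m)) / (1 - th))%:E)%E.
  elim: m => [|m IHm].
    by rewrite addn0 subrr mulr0 mul0r adde0.
  apply: (le_trans IHm); rewrite addnS.
  apply: (le_trans (leeD2r _ (step _))).
  rewrite -addeA leeD2l // -EFinD lee_fin.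
  rewrite le_eqVlt; apply/orP; left; apply/eqP.
  by rewrite exprS; field; rewrite subr_eq0 gt_eqF.
apply/lee_addgt0Pr => e e0.
pose c := fine ('N f).
have cE : 'N f = c%:E by rewrite fineK // ge0_fin_numE ?Lnorm_ge0.
have c0 : 0 <= c by rewrite fine_ge0 ?Lnorm_ge0.
have rho1 : `|2 `^ (- p^-1)| < 1 :> R.
  by rewrite ger0_norm ?powR_ge0 // two_powRN_lt1 // invr_gt0.
have [m hm] : exists m, c * (2 `^ (- p^-1)) ^+ m <= e.
  have /cvgrPdist_le/(_ _ e0)[m _ hm] := cvg_geometric c rho1.
  exists m; have := hm m (leqnn _).
  by rewrite /= sub0r normrN ger0_norm // mulr_ge0 // exprn_ge0 // powR_ge0.
have := ind m => /le_trans; apply.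
rewrite addeC; apply: leeD.
  rewrite lee_fin ler_wpM2r ?invr_ge0 ?subr_ge0 ?(ltW th1) //.
  by rewrite ler_wpM2l // gerBl exprn_ge0.
apply: (le_trans (Lnorm_avg_le p1 _ mK sK mf)).
rewrite cE -EFinM lee_fin (le_trans _ hm) // mulrC ler_wpM2l // two_powR.
rewrite exprD ler_piMl ?exprn_ge0 ?powR_ge0 // exprn_ile1 ?powR_ge0 //.
by rewrite ltW // (le_lt_trans _ rho1) // ler_norm.
Qed.

(** Both K and its translate contribute to the translation difference. *)
Lemma int_translate_pieces K v f (i : nat) :
  measurable K -> separated K v -> measurable_fun setT f ->
  (\int[mu]_x (\1_K x * `|f (x + i%:R *: v)%R - f x| `^ p)%:E +
   \int[mu]_x (\1_K x * `|f (x + i%:R *: - v)%R - f x| `^ p)%:E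
   <= 'N (fun x => f (x + i%:R *: v) - f x)%R `^ p)%E.
Proof.
move=> mK sK mf; rewrite Lnorm_powE //.
have mD w : measurable_fun setT (fun x => `|f (x + w) - f x| `^ p).
  apply: measurable_powR_norm; apply: measurable_funB => //.
  exact: measurable_comp_shift.
have mI : measurable_fun setT (\1_K : 'rV[R]_n -> R) by exact: measurable_indic.
(* for i = 0 all the differences vanish *)
case: i => [|i].
  rewrite !scale0r; rewrite !integral0_eq ?adde0 //;
    by move=> x _; rewrite addr0 subrr normr0 powR0 ?gt_eqF // mulr0.
set w := i.+1%:R *: v.
have -> : (\int[mu]_x (\1_K x * `|f (x + i.+1%:R *: - v)%R - f x| `^ p)%:E =
  \int[mu]_x (\1_K (x + w)%R * `|f (x + w)%R - f x| `^ p)%:E)%E.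
  rewrite -(ge0_int_shift w (g := fun x => \1_K x * `|f (x + i.+1%:R *: - v) - f x| `^ p)).
  - by apply: eq_integral => x _; rewrite scalerN addrK distrC.
  - exact: measurable_funM.
  - by move=> x; rewrite mulr_ge0 ?powR_ge0.
rewrite -ge0_integralD //; last 2 first.
- by apply/measurable_EFinP; apply: measurable_funM.
- apply/measurable_EFinP; apply: measurable_funM => //.
  exact: (measurable_comp_shift w mI).
apply: ge0_le_integral_gen => // x _.
  by rewrite -EFinD lee_fin addr_ge0 ?mulr_ge0 ?powR_ge0.
rewrite /= -EFinD lee_fin -mulrDl -[leRHS]mul1r.
apply: ler_wpM2r; first exact: powR_ge0.
rewrite !indicE; case: (boolP (x \in K)) => xK;
  case: (boolP (x + w \in K)) => xwK; rewrite ?addr0 ?add0r //.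
by rewrite !inE in xK xwK; case: (sK i.+1 _ x xK xwK).
Qed.

Lemma Lnorm_avgB K v f (s : nat) :
  measurable K -> measurable_fun setT f ->
  ('N (fun x => \1_K x * (avg s v f x - f x))%R `^ p <=
   ((2 ^+ s)^-1)%:E * \sum_(i < 2 ^ s)
     \int[mu]_x (\1_K x * `|f (x + i%:R *: v)%R - f x| `^ p)%:E)%E.
Proof.
move=> mK mf; rewrite Lnorm_powE //.
have mD w : measurable_fun setT (fun x => `|f (x + w) - f x| `^ p).
  apply: measurable_powR_norm; apply: measurable_funB => //.
  exact: measurable_comp_shift.
have mI : measurable_fun setT (\1_K : 'rV[R]_n -> R) by exact: measurable_indic.
rewrite -ge0_integral_sum //; last first.
  by move=> i; apply/measurable_EFinP; apply: measurable_funM.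
rewrite -ge0_integralZl_EFin //; last 2 first.
- by move=> x _; rewrite sume_ge0 // => i _; rewrite lee_fin mulr_ge0 ?powR_ge0.
- by apply: emeasurable_sum => i; apply/measurable_EFinP; apply: measurable_funM.
apply: ge0_le_integral_gen => // [x _|].
  rewrite mule_ge0 ?lee_fin ?invr_ge0 ?exprn_ge0 //.
  by rewrite sume_ge0 // => i _; rewrite lee_fin mulr_ge0 ?powR_ge0.
move=> x _ /=; rewrite sumEFin -EFinM lee_fin -mulr_sumr mulrCA indicE.
case: (_ \in _); rewrite ?mulr1n ?mulr0n; last first.
  by rewrite !mul0r normr0 powR0 ?gt_eqF.
rewrite !mul1r.
have -> : avg s v f x - f x = avg s v (fun y => f y - f x) x.
  by rewrite avgB avg_cst.
exact: powR_avg.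
Qed.

(** A function that is at least 1 on K and has small averages there, in both
    directions, differs much from one of its translates. *)
Lemma modulus_lower K v f (s : nat) (W eta : R) :
  measurable K -> (mu K < +oo)%E -> separated K v -> measurable_fun setT f ->
  (forall x, K x -> 1 <= f x) -> 0 <= W ->
  0 <= eta -> eta <= fine (mu K) `^ p^-1 ->
  (forall i : nat, (i < 2 ^ s)%N ->
     ('N (fun x => f (x + i%:R *: v) - f x)%R <= W%:E)%E) ->
  ('N (fun x => \1_K x * avg s v f x)%R <= eta%:E)%E ->
  ('N (fun x => \1_K x * avg s (- v) f x)%R <= eta%:E)%E ->
  2 * (fine (mu K) `^ p^-1 - eta) `^ p <= W `^ p.
Proof.
move=> mK Kfin sK mf f1 W0 eta0 etam hW hp hm.
set m := fine (mu K).
have mE : mu K = m%:E by rewrite fineK // ge0_fin_numE.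
have m0 : 0 <= m by rewrite fine_ge0.
have mI : measurable_fun setT (\1_K : 'rV[R]_n -> R) by exact: measurable_indic.
have Nf : ((m `^ p^-1)%:E <= 'N (fun x => \1_K x * f x)%R)%E.
  apply: (le_poweR_inv p1); rewrite ?Lnorm_ge0 ?lee_fin ?powR_ge0 //.
  rewrite Lnorm_powE // poweR_EFin -powRrM mulVf ?gt_eqF // powRr1 // -mE.
  rewrite -[K]setIT -integral_indic // setIT.
  apply: ge0_le_integral_gen => // x _; rewrite lee_fin.
  rewrite indicE; case: (boolP (x \in K)) => xK; last exact: powR_ge0.
  rewrite mulr1n mul1r; apply: (@le_trans _ _ (1 `^ p)); first by rewrite powR1.
  have := f1 x; rewrite inE in xK => /(_ xK) fx.
  apply: ge0_ler_powR; rewrite ?nnegrE ?(ltW p0) // ger0_norm //.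
  by rewrite (le_trans _ fx).
have L w : ('N (fun x => \1_K x * avg s w f x)%R <= eta%:E)%E ->
    (((m `^ p^-1 - eta) `^ p)%:E <=
       'N (fun x => \1_K x * (avg s w f x - f x))%R `^ p)%E.
  move=> hw; rewrite -poweR_EFin; apply: gt0_ler_poweR.
  - exact: ltW.
  - by rewrite in_itv /= leey andbT lee_fin subr_ge0.
  - by rewrite in_itv /= leey andbT Lnorm_ge0.
  rewrite EFinB leeBlDr //; apply: (le_trans Nf).
  apply: (@le_trans _ _ ('N (fun x => \1_K x * (f x - avg s w f x))%R +
      'N (fun x => \1_K x * avg s w f x)%R)%E).
    have -> : (fun x => \1_K x * f x) = (fun x => \1_K x * (f x - avg s w f x))
        \+ (fun x => \1_K x * avg s w f x).
      by apply/funext => x /=; rewrite -mulrDr subrK.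
    have ma := measurable_avg s w mf.
    apply: minkowski_EFin => //; apply: measurable_funM => //.
    exact: measurable_funB.
  apply: leeD => //; apply: le_Lnorm => x.
  by rewrite !normrM distrC.
rewrite -lee_fin mulr2n mulrDl !mul1r EFinD.
apply: (le_trans (leeD (L _ hp) (L _ hm))).
apply: (le_trans (leeD (Lnorm_avgB _ _ mK mf) (Lnorm_avgB _ _ mK mf))).
rewrite -ge0_muleDr; last 2 first.
- by apply: sume_ge0 => i _; apply: integral_ge0 => x _; rewrite lee_fin mulr_ge0 ?powR_ge0.
- by apply: sume_ge0 => i _; apply: integral_ge0 => x _; rewrite lee_fin mulr_ge0 ?powR_ge0.
rewrite -big_split /=.
apply: (@le_trans _ _ (((2 ^+ s)^-1)%:E * \sum_(i < 2 ^ s) (W `^ p)%:E)%E).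
  apply: lee_wpmul2l; first by rewrite lee_fin invr_ge0 exprn_ge0.
  apply: lee_sum => i _; apply: (le_trans (int_translate_pieces _ mK sK mf)).
  rewrite -poweR_EFin; apply: gt0_ler_poweR.
  - exact: ltW.
  - by rewrite in_itv /= leey andbT Lnorm_ge0.
  - by rewrite in_itv /= leey andbT lee_fin.
  exact: hW.
rewrite sumEFin -EFinM lee_fin sumr_const card_ord -[_ *+ (2 ^ s)]mulr_natl.
by rewrite mulrA natrX mulVf ?mul1r // expf_neq0.
Qed.

End lower_bound.

(** * Smooth functions built from exp (- 1 / t) *)

Section flat.
Variable R : realType.

(** The functions t ^ (- k) exp (- 1 / t) for t > 0, extended by 0: the span of
    this family is stable under differentiation. *)
Definition flat (k : nat) (t : R) : R :=
  if 0 < t then t^-1 ^+ k * expR (- t^-1) else 0.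

Lemma flat_ge0 k t : 0 <= flat k t.
Proof.
rewrite /flat; case: ifP => // t0.
by rewrite mulr_ge0 ?expR_ge0 // exprn_ge0 // invr_ge0 ltW.
Qed.

Lemma flat_gt0 k t : (0 < flat k t) = (0 < t).
Proof.
rewrite /flat; case: ifP => t0; last exact: ltxx.
by rewrite mulr_gt0 ?expR_gt0 // exprn_gt0 // invr_gt0.
Qed.

Lemma flat0_le1 t : flat 0 t <= 1.
Proof.
rewrite /flat; case: ifP => // t0; rewrite expr0 mul1r -expR0 ler_expR.
by rewrite oppr_le0 invr_ge0 ltW.
Qed.

Lemma flat_le_sqr k t : flat k t <= (k.+2)`!%:R * t ^+ 2.
Proof.
rewrite /flat; case: ifP => t0; last by rewrite mulr_ge0 // sqr_ge0.
have u0 : 0 < t^-1 by rewrite invr_gt0.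
rewrite expRN ler_pdivrMr ?expR_gt0 // mulrC.
have F0 : 0 < (k.+2)`!%:R :> R by rewrite ltr0n fact_gt0.
have := expR_ge1Dxn k.+1 (ltW u0) => h.
have {}h : t^-1 ^+ k.+2 / (k.+2)`!%:R <= expR t^-1.
  by apply: le_trans h; rewrite lerDr.
rewrite ler_pdivrMr // in h.
have t2 : 0 < t ^+ 2 by rewrite exprn_gt0.
have -> : t^-1 ^+ k = t^-1 ^+ k.+2 * t ^+ 2.
  rewrite -addn2 exprD -mulrA -exprMn mulVf ?gt_eqF // expr1n mulr1.
  by [].
apply: (le_trans (ler_wpM2r (ltW t2) h)).
by rewrite le_eqVlt; apply/orP; left; apply/eqP; ring.
Qed.

Lemma is_derive_flat k (t : R) :
  is_derive t 1 (flat k) (flat k.+2 t - k%:R * flat k.+1 t).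
Proof.
have [t0|t0|->] := ltgtP t 0.
- rewrite /flat !ltNge (ltW t0) /= mulr0 subr0.
  apply: (@near_eq_is_derive _ _ _ (cst 0)).
  near=> s; rewrite /cst; case: ifP => // s0.
  suff : s < 0 by rewrite ltNge (ltW s0).
  by near: s; exact: lt_nbhsl.
- have du : is_derive t 1 (fun s : R => s^-1) (- t ^- 2).
    have := @is_deriveV R id t 1 1 (negbT (gt_eqF t0)) (is_derive_id t 1).
    by rewrite /GRing.scale /= mulr1.
  set u := t^-1.
  have dP : is_derive u 1 (fun s : R => s ^+ k * expR (- s))
     (k%:R * u ^+ k.-1 * expR (- u) - u ^+ k * expR (- u)).
    have de : is_derive u 1 (expR \o -%R) (- expR (- u)).
      have := @is_derive1_comp _ expR -%R u _ _ (is_derive_expR (- u))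
        (is_deriveN (is_derive_id u 1)).
      by rewrite mulrN mulr1.
    have := is_deriveM (is_deriveX k (is_derive_id u 1)) de.
    rewrite /GRing.scale /= mulr1 mulrN addrC [X in X - _]mulrC.
    have -> : (id ^+ k : R -> R) = (fun s => s ^+ k) by apply/funext => s; rewrite exprfctE.
    by [].
  have := is_derive1_comp dP du => h.
  apply: (@near_eq_is_derive _ _ _ ((fun s : R => s ^+ k * expR (- s)) \o (fun s : R => s^-1))).
    near=> s; rewrite /flat /=; case: ifPn => //; rewrite -leNgt => s0.
    suff : 0 < s by rewrite ltNge s0.
    by near: s; exact: lt_nbhsr.
  apply: (is_derive_eq h).
  rewrite /flat t0 -/u -exprVn -/u; case: k {dP h} => [|k] /=; last by rewrite !exprS; ring.
  by rewrite !exprS; ring.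
- rewrite /flat ltxx mulr0 subr0.
  (* flat k t = O(t ^ 2) at 0 *)
  have lim0 : h^-1 *: ((flat k \o shift 0) (h *: (1 : R)) - flat k 0) @[h --> (0:R)^'] --> (0 : R).
    apply/cvgrPdist_le => e e0; near=> h.
    have h0 : h != 0 by near: h; exact: nbhs_dnbhs_neq.
    rewrite sub0r normrN /= addr0 /GRing.scale /= mulr1.
    rewrite {2}/flat ltxx subr0 normrM [`|flat _ _|]ger0_norm ?flat_ge0 //.
    rewrite normfV ler_pdivrMl ?normr_gt0 //.
    apply: (le_trans (flat_le_sqr k h)).
    rewrite -[h ^+ 2]ger0_norm ?sqr_ge0 // normrX expr2 mulrCA.
    rewrite ler_wpM2l //.
    have F0 : 0 < (k.+2)`!%:R :> R by rewrite ltr0n fact_gt0.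
    rewrite -ler_pdivlMl // mulrC; near: h.
    apply: dnbhs0_le; exact: divr_gt0.
  apply: DeriveDef; first by apply/cvg_ex; exists 0.
  by rewrite /derive; apply: cvg_lim.
Unshelve. all: by end_near. Qed.

Lemma continuous_flat k : continuous (flat k).
Proof.
move=> t; apply: differentiable_continuous; apply/derivable1_diffP.
by have [] := is_derive_flat k t.
Qed.

End flat.

Section flat_algebra.
Variables (R : realType) (n : nat).
Implicit Types f g : 'rV[R]_n -> R.

(** The algebra generated by the constants and the functions flat m of an affine
    function of one coordinate. *)
Inductive flat_algebra : ('rV[R]_n -> R) -> Prop :=
| flat_algebra_cst c : flat_algebra (fun=> c)
| flat_algebra_coord m a b (j : 'I_n) :
    flat_algebra (fun x => flat m (a * x ord0 j + b))
| flat_algebraD f g : flat_algebra f -> flat_algebra g ->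
    flat_algebra (fun x => f x + g x)
| flat_algebraM f g : flat_algebra f -> flat_algebra g ->
    flat_algebra (fun x => f x * g x).

Lemma flat_algebra_prod (I : Type) (s : seq I) (F : I -> 'rV[R]_n -> R) :
  (forall i, flat_algebra (F i)) -> flat_algebra (fun x => \prod_(i <- s) F i x).
Proof.
move=> hF; elim: s => [|i s IHs].
  rewrite (_ : (fun _ => _) = (fun=> 1)); last by apply/funext => x; rewrite big_nil.
  exact: flat_algebra_cst.
rewrite (_ : (fun _ => _) = (fun x => F i x * \prod_(j <- s) F j x)); last first.
  by apply/funext => x; rewrite big_cons.
exact: flat_algebraM.
Qed.

Lemma flat_algebra_exp f (N : nat) : flat_algebra f -> flat_algebra (fun x => f x ^+ N).
Proof.
move=> hf; elim: N => [|N IHN].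
  rewrite (_ : (fun _ => _) = (fun=> 1)); last by apply/funext => x; rewrite expr0.
  exact: flat_algebra_cst.
rewrite (_ : (fun _ => _) = (fun x => f x * f x ^+ N)); last first.
  by apply/funext => x; rewrite exprS.
exact: flat_algebraM.
Qed.

Lemma flat_algebra_continuous f : flat_algebra f -> continuous f.
Proof.
elim => [c|m a b j|f' g _ cf _ cg|f' g _ cf _ cg] x.
- exact: cst_continuous.
- apply: (@continuous_comp _ _ _ (fun y : 'rV[R]_n => a * y ord0 j + b) (flat m)).
    apply: (@continuousD _ _ _ (fun y : 'rV[R]_n => a * y ord0 j) (cst b)).
      apply: (@continuousM _ _ (cst a) (fun y : 'rV[R]_n => y ord0 j)).
        exact: cst_continuous.
      exact: coord_continuous.
    exact: cst_continuous.
  exact: continuous_flat.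
- by apply: (@continuousD _ _ _ f' g); [exact: cf|exact: cg].
- by apply: (@continuousM _ _ f' g); [exact: cf|exact: cg].
Qed.

Lemma flat_algebra_derive f (k : 'I_n) : flat_algebra f ->
  exists2 g, flat_algebra g & forall x, is_derive x (unit_vector R k) f (g x).
Proof.
elim => [c|m a b j|f1 f2 hf1 [g1 hg1 d1] hf2 [g2 hg2 d2]
        |f1 f2 hf1 [g1 hg1 d1] hf2 [g2 hg2 d2]].
- exists (fun=> 0); first exact: flat_algebra_cst.
  by move=> x; exact: is_derive_cst.
- pose d : R := unit_vector R k ord0 j.
  exists (fun x => (a * d) * (flat m.+2 (a * x ord0 j + b) +
    (- m%:R) * flat m.+1 (a * x ord0 j + b))).
    apply: flat_algebraM; first exact: flat_algebra_cst.
    apply: flat_algebraD; first exact: flat_algebra_coord.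
    by apply: flat_algebraM; [exact: flat_algebra_cst|exact: flat_algebra_coord].
  move=> x; set c := a * x ord0 j + b.
  pose l (h : R) := (a * d) * h + c.
  have dl : is_derive (0 : R) 1 l (a * d).
    have := is_deriveD (is_deriveZ (a * d) (is_derive_id (0 : R) 1))
      (is_derive_cst c (0 : R) 1).
    by rewrite /GRing.scale /= mulr1 addr0.
  have l0 : l 0 = c by rewrite /l mulr0 add0r.
  have := @is_derive1_comp _ (flat m) l 0 _ _ (is_derive_flat m (l 0)) dl.
  rewrite l0 mulrC => -[ex val].
  have E : flat m \o l = (fun h : R => flat m (a * (h *: unit_vector R k + x) ord0 j + b)).
    by apply/funext => h /=; rewrite /l /c !mxE /d; congr flat; rewrite /unit_vector mxE; ring.
  apply: DeriveDef.
    apply: (proj2 (derivable1P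
      (fun y : 'rV[R]_n => flat m (a * y ord0 j + b)) x (unit_vector R k))).
    by rewrite E in ex.
  rewrite mulNr -val /derive.
  have -> // : (fun h : R => h^-1 *: (((fun y : 'rV[R]_n => flat m (a * y ord0 j + b))
       \o shift x) (h *: unit_vector R k) - flat m (a * x ord0 j + b))) =
     (fun h : R => h^-1 *: (((flat m \o l) \o shift 0) (h *: (1 : R)) - (flat m \o l) 0)).
  by apply/funext => h; rewrite E /= addr0 scale0r add0r /GRing.scale /= mulr1.
- exists (fun x => g1 x + g2 x); first exact: flat_algebraD.
  by move=> x; exact: is_deriveD.
- exists (fun x => f1 x * g2 x + f2 x * g1 x).
    by apply: flat_algebraD; apply: flat_algebraM.
  by move=> x; exact: is_deriveM.
Qed.

Lemma flat_algebra_smooth f : flat_algebra f -> smooth f.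
Proof.
move=> hf s.
have {}hf : flat_algebra (iterated_partial s f).
  elim: s => [//|k s IHs] /=.
  have [g hg dg] := flat_algebra_derive k IHs.
  suff -> : 'D_(unit_vector R k) (iterated_partial s f) = g by [].
  by apply/funext => x; have [] := dg x.
split; first exact: flat_algebra_continuous.
by move=> x k; have [g _ dg] := flat_algebra_derive k hf; have [] := dg x.
Qed.

End flat_algebra.

(** * Moduli of continuity of test functions *)

Section cubes.
Variables (R : realType) (n : nat).

(** The closed ball of centre 0 and radius M for the sup norm. *)
Definition cube (M : R) : set 'rV[R]_n := [set x | forall i, `|x ord0 i| <= M].

Lemma cube_compact M : compact (cube M).
Proof.
have := @rV_compact R n (fun=> `[- M, M]%classic) (fun=> segment_compact (b := M)).
congr (compact _); apply/seteqP; split => x /= h i;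
  by have := h i; rewrite /= ?in_itv /= ?ler_norml.
Qed.

Lemma cube_measurable M : measurable (cube M).
Proof. by apply: compact_measurable_rV; exact: cube_compact. Qed.

Lemma cube_finite M : (lebesgue_rV R n (cube M) < +oo)%E.
Proof. by apply: (@lebesgue_rV_bounded _ _ _ M) => //; exact: cube_measurable. Qed.

Lemma compact_sub_cube (K : set 'rV[R]_n) : compact K ->
  exists2 M, 0 < M & K `<=` cube M.
Proof.
move=> /compact_bounded /ex_strict_bound_gt0 [M M0 hM].
exists M => // x Kx i; have xM : `|x| < M by exact: hM.
have : ball (0 : 'rV[R]_n) M x by rewrite mx_norm_ball /ball_ /= sub0r normrN.
by move=> /(ball_rVE _ _ M0)/(_ i); rewrite mxE sub0r normrN => /ltW.
Qed.

Lemma continuous_bounded_cube (g : 'rV[R]_n -> R) (M : R) : continuous g ->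
  exists2 L, 0 <= L & forall x, cube M x -> `|g x| <= L.
Proof.
move=> cg; have [ne|em] := pselect (cube M !=set0); last first.
  by exists 0 => // x Kx; case: em; exists x.
have [|c cK hc] := @EVT_max_rV R n (fun x => `|g x|) _ ne (@cube_compact M).
  apply: continuous_subspaceT => x.
  by apply: (@continuous_comp _ _ _ g); [exact: cg|exact: norm_continuous].
by exists `|g c| => // x Kx; apply: hc; rewrite inE.
Qed.

End cubes.

Section test_functions.
Variables (R : realType) (n : nat) (p : R).
Hypothesis p1 : 1 <= p.
Local Notation mu := (lebesgue_rV R n).
Local Notation "''N' f" := (Lnorm mu p%:E (EFin \o f)) (at level 8, f at level 2).
Implicit Types (f g : 'rV[R]_n -> R) (x : 'rV[R]_n) (k : 'I_n).

Let p0 : 0 < p. Proof. by rewrite (lt_le_trans _ p1). Qed.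

Lemma smooth_continuous f : smooth f -> continuous f.
Proof. by move=> /(_ [::])[]. Qed.

Lemma compactly_supported_cube f : compactly_supported f ->
  exists2 M, 0 < M & forall x, f x != 0 -> cube M x.
Proof.
move=> /compact_sub_cube [M M0 hM]; exists M => // x fx.
by apply: hM; exact: subset_closure.
Qed.

Lemma Lnorm_pow_le_indic g (B : set 'rV[R]_n) (c : R) :
  measurable B -> 0 <= c -> (forall x, `|g x| <= c * \1_B x) ->
  ('N g `^ p <= (c `^ p)%:E * mu B)%E.
Proof.
move=> mB c0 hg; rewrite Lnorm_powE //.
have -> : ((c `^ p)%:E * mu B = \int[mu]_x ((c `^ p)%:E * (\1_B x)%:E))%E.
  rewrite ge0_integralZl_EFin ?powR_ge0 //.
    by rewrite integral_indic // setIT.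
  by apply/measurable_EFinP; exact: measurable_indic.
apply: ge0_le_integral_gen => // [x _|x _].
  by rewrite -EFinM lee_fin mulr_ge0 ?powR_ge0.
rewrite -EFinM lee_fin; apply: (@le_trans _ _ ((c * \1_B x) `^ p)).
  by apply: ge0_ler_powR; rewrite ?nnegrE ?(ltW p0) // mulr_ge0.
rewrite powRM // ler_wpM2l ?powR_ge0 // indicE.
by case: (_ \in _); rewrite ?powR1 // powR0 // gt_eqF.
Qed.

Lemma Lnorm_lty f : continuous f -> compactly_supported f -> ('N f < +oo)%E.
Proof.
move=> cf /compactly_supported_cube [M M0 hM].
have [L L0 hL] := continuous_bounded_cube M cf.
have : ('N f `^ p < +oo)%E.
  apply: (le_lt_trans (@Lnorm_pow_le_indic f (cube M) L _ L0 _)).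
  - exact: cube_measurable.
  - move=> x; rewrite indicE; have [xB|xB] := boolP (x \in cube M).
      by rewrite mulr1 hL // -inE.
    rewrite mulr0 normr_le0; apply: contraNT xB => /hM xB.
    by rewrite inE.
  - by rewrite lte_mul_pinfty ?lee_fin ?powR_ge0 //; exact: cube_finite.
by apply: lty_poweRy; rewrite gt_eqF.
Qed.

(** The derivative along e is the derivative of the restriction to a line. *)
Lemma is_derive_line f (e : 'rV[R]_n) x (s : R) :
  derivable f (s *: e + x) e ->
  is_derive s 1 (fun t : R => f (t *: e + x)) ('D_e f (s *: e + x)).
Proof.
move=> df.
have E : (fun h : R => h^-1 *: (((fun t : R => f (t *: e + x)) \o shift s) (h *: (1 : R))
     - f (s *: e + x))) =
   (fun h : R => h^-1 *: ((f \o shift (s *: e + x)) (h *: e) - f (s *: e + x))).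
  apply/funext => h /=; congr (_ *: (f _ - _)).
  have -> : h *: (1 : R) = h by rewrite /GRing.scale /= mulr1.
  by rewrite scalerDl addrA.
by apply: DeriveDef; [rewrite /derivable E|rewrite /derive E].
Qed.

(** The increments of f vanish outside a cube as soon as h <= 1. *)
Lemma smooth_lipschitz f k : smooth f -> compactly_supported f ->
  exists M, exists2 L, 0 <= L & forall x (h : R), 0 <= h <= 1 ->
    `|f (x + h *: unit_vector R k) - f x| <= L * h * \1_(cube M) x.
Proof.
move=> sf /compactly_supported_cube [M M0 hM].
have [_ df] := sf [::]; have [cD _] := sf [:: k].
have [L L0 hL] := continuous_bounded_cube (M + 2) cD.
have ek i : `|unit_vector R k ord0 i| <= 1.
  by rewrite mxE; case: (_ && _); rewrite ?normr1 ?normr0.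
have cubeD x (h a : R) : 0 <= h <= 1 -> cube a x -> cube (a + 1) (x + h *: unit_vector R k).
  move=> /andP[h0 h1] xa i; rewrite !mxE.
  apply: (le_trans (ler_normD _ _)); apply: lerD => //.
  rewrite normrM ger0_norm // -[leRHS]mulr1; apply: ler_pM => //.
  by have := ek i; rewrite mxE.
exists (M + 1), L => // x h /andP[h0 h1].
rewrite indicE; have [xB|xB] := boolP (x \in cube (M + 1)); last first.
  rewrite mulr0 (_ : f x = 0) ?subr0; last first.
    apply/eqP; apply: contraNT xB => /hM xM; rewrite inE => i.
    by rewrite (le_trans (xM i)) // lerDl.
  rewrite (_ : f _ = 0) ?normr0 //; apply/eqP; apply: contraNT xB => /hM xM.
  rewrite inE => i; have := xM i; rewrite !mxE => xi.
  rewrite -[x ord0 i](addrK (h * unit_vector R k ord0 i)).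
  apply: (le_trans (ler_normB _ _)); apply: lerD; first by rewrite mxE.
  by rewrite normrM ger0_norm // -[leRHS]mulr1; apply: ler_pM.
rewrite mulr1; rewrite inE in xB.
set e := unit_vector R k.
have [||c] := @MVT_segment R (fun t => f (t *: e + x)) (fun t => 'D_e f (t *: e + x)) 0 h h0.
- by move=> t _; apply: is_derive_line; exact: df.
- apply: continuous_subspaceT => t.
  apply: differentiable_continuous; apply/derivable1_diffP.
  by have [] := @is_derive_line f e x t (df _ _).
rewrite in_itv /= => /andP[c0 ch]; rewrite scale0r add0r subr0 [x + _]addrC => ->.
rewrite normrM [`|h|]ger0_norm // ler_wpM2r //.
apply: hL; rewrite (_ : M + 2 = M + 1 + 1); last by ring.
by rewrite [c *: e + x]addrC; apply: cubeD => //; rewrite c0 (le_trans ch).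
Qed.

Lemma partial_modulus_lipschitz f k : smooth f -> compactly_supported f ->
  exists2 C, 0 <= C & forall t : R, 0 < t <= 1 ->
    (partial_modulus k f t p <= (C * t)%:E)%E.
Proof.
move=> sf cf; have [M [L L0 hL]] := smooth_lipschitz k sf cf.
set m := fine (mu (cube M)).
have mE : mu (cube M) = m%:E.
  by rewrite fineK // ge0_fin_numE //; exact: cube_finite.
have m0 : 0 <= m by rewrite fine_ge0.
exists (L * m `^ p^-1); first by rewrite mulr_ge0 ?powR_ge0.
move=> t /andP[t0 t1]; apply: ge_ereal_sup => _ [h /= + <-].
rewrite in_itv /= => /andP[h0 ht].
have h1 : h <= 1 by rewrite (le_trans ht).
apply: (le_poweR_inv p1).
- exact: Lnorm_ge0.
- by rewrite lee_fin !mulr_ge0 ?powR_ge0 // ltW.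
apply: (le_trans (@Lnorm_pow_le_indic (fun x => f (x + h *: unit_vector R k) - f x)
   (cube M) (L * h) _ _ _)).
- exact: cube_measurable.
- by rewrite mulr_ge0.
- by move=> x; apply: hL; rewrite h0.
rewrite mE -EFinM poweR_EFin lee_fin mulrAC.
rewrite [leRHS]powRM ?mulr_ge0 ?powR_ge0 ?(ltW t0) //.
rewrite -powRrM mulVf ?gt_eqF // powRr1 // ler_wpM2r //.
apply: ge0_ler_powR; rewrite ?nnegrE ?mulr_ge0 ?(ltW p0) ?(ltW t0) //.
by rewrite ler_wpM2l.
Qed.

(** For a, b >= 0, |a - b| ^ p <= a ^ p + b ^ p; hence the factor 2. *)
Lemma partial_modulus_nonneg f k (t I : R) : measurable_fun setT f ->
  (forall x, 0 <= f x) -> ('N f `^ p <= I%:E)%E ->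
  (partial_modulus k f t p <= ((2 * I) `^ p^-1)%:E)%E.
Proof.
move=> mf f0 hI.
have I0 : 0 <= I by rewrite -lee_fin (le_trans _ hI) // poweR_ge0.
apply: ge_ereal_sup => _ [h /= _ <-].
set w := h *: _.
apply: (le_poweR_inv p1).
- exact: Lnorm_ge0.
- by rewrite lee_fin powR_ge0.
rewrite poweR_EFin -powRrM mulVf ?gt_eqF // powRr1 ?mulr_ge0 //.
rewrite -/(EFin \o (fun x => f (x + w) - f x)) Lnorm_powE //.
have mfp := measurable_powR_norm p mf.
apply: (@le_trans _ _ (\int[mu]_x ((`|f (x + w)%R| `^ p)%:E + (`|f x| `^ p)%:E))%E).
  apply: ge0_le_integral_gen => // [x _|x _]; first by rewrite adde_ge0 // lee_fin powR_ge0.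
  rewrite -EFinD lee_fin.
  have [le|lt] := leP (f x) (f (x + w)).
    rewrite -[leLHS]addr0 lerD ?powR_ge0 //.
    apply: ge0_ler_powR; rewrite ?nnegrE ?(ltW p0) // !ger0_norm ?subr_ge0 //.
    by rewrite gerBl.
  rewrite -[leLHS]add0r lerD ?powR_ge0 // distrC.
  apply: ge0_ler_powR; rewrite ?nnegrE ?(ltW p0) // !ger0_norm ?subr_ge0 ?(ltW lt) //.
  by rewrite gerBl.
rewrite ge0_integralD //; last 2 first.
- by apply/measurable_EFinP; exact: (measurable_comp_shift w mfp).
- exact/measurable_EFinP.
rewrite (ge0_int_shift w (g := fun x => `|f x| `^ p)) //.
rewrite -Lnorm_powE // mulr2n mulrDl mul1r EFinD.
exact: leeD.
Qed.

End test_functions.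

(** * Test functions concentrated near a compact set *)

Section cutoff.
Variables (R : realType) (n : nat).
Local Notation mu := (lebesgue_rV R n).
Implicit Types (K : set 'rV[R]_n) (c x : 'rV[R]_n) (r : R).

(** The open r-neighbourhood of K for the sup norm. *)
Definition thickening K r : set 'rV[R]_n := \bigcup_(c in K) ball c r.

Lemma thickening_measurable K r : measurable (thickening K r).
Proof.
apply: open_measurable_rV; apply: bigcup_open => c _; have [r0|r0] := ltP 0 r.
  exact: ball_open.
rewrite (_ : ball c r = set0); first exact: open0.
by rewrite -subset0 => y []; rewrite ltNge r0.
Qed.

Lemma thickening_sub_cube K r : compact K -> 0 < r ->
  exists M, thickening K r `<=` cube M.
Proof.
move=> /compact_sub_cube [M M0 hM] r0; exists (M + r) => x [c Kc].
move=> /(ball_rVE _ _ r0) cx i.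
rewrite -[x ord0 i](subrK (c ord0 i)) addrC (le_trans (ler_normD _ _)) //.
by apply: lerD; [exact: hM|rewrite distrC ltW].
Qed.

Lemma thickening_measure K (e : R) : compact K -> 0 < e ->
  exists2 r, 0 < r & (mu (thickening K r) <= (fine (mu K) + e)%:E)%E.
Proof.
move=> cK e0; pose F (m : nat) := thickening K m.+1%:R^-1.
have r0 (m : nat) : 0 < m.+1%:R^-1 :> R by rewrite invr_gt0.
have fin : (mu K < +oo)%E.
  have [M _ hM] := compact_sub_cube cK.
  by apply: (@lebesgue_rV_bounded _ _ _ M) => //; exact: compact_measurable_rV.
have mKE : mu K = (fine (mu K))%:E by rewrite fineK // ge0_fin_numE.
have FK : \bigcap_m F m = K.
  apply/seteqP; split => x.
    move=> hx; have clK : closed K by apply: compact_closed => //; exact: norm_hausdorff.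
    rewrite [K](closure_id _).1 // => B /nbhs_ballP[d /= d0 dB].
    have [m _ /(_ m (leqnn _)) /= md] := near_infty_natSinv_lt (PosNum d0).
    have [c Kc cx] := hx m I.
    by exists c; split => //; apply: dB; apply: ball_sym; apply: le_ball cx; exact: ltW.
  by move=> Kx m _; exists x => //; apply: ballxx; rewrite ?r0.
have FS m l : (m <= l)%N -> F l `<=` F m.
  move=> ml x [c Kc cx]; exists c => //; apply: le_ball cx.
  by rewrite lef_pV2 ?posrE // ler_nat.
have cv : (mu \o F) m @[m --> \oo] --> mu K.
  rewrite -FK; apply: nonincreasing_cvg_mu.
  - have [M hM] := thickening_sub_cube cK (r0 0%N).
    by apply: (@lebesgue_rV_bounded _ _ _ M) => //; exact: thickening_measurable.
  - by move=> m; exact: thickening_measurable.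
  - by rewrite FK; exact: compact_measurable_rV.
  - by move=> m l ml; rewrite subsetEset; exact: FS.
apply: contrapT => no.
have : ((fine (mu K) + e)%:E <= mu K)%E.
  rewrite -[leRHS](cvg_lim _ cv) //; apply: lime_ge; first by apply/cvg_ex; exists (mu K).
  apply: nearW => m; rewrite leNgt; apply/negP => lt; apply: no.
  by exists m.+1%:R^-1; [exact: r0|exact: ltW].
by rewrite mKE lee_fin leNgt ltrDl e0.
Qed.

(** A smooth function in [0, 1] that is positive exactly on the ball (for the
    sup norm) of centre c and radius r. *)
Definition bump c r x : R := \prod_(j < n)
  (flat 0 (1 * x ord0 j + (r - c ord0 j)) *
   flat 0 ((-1) * x ord0 j + (r + c ord0 j))).

Lemma flat_algebra_bump c r : flat_algebra (bump c r).
Proof.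
apply: flat_algebra_prod => j.
by apply: flat_algebraM; exact: flat_algebra_coord.
Qed.

Lemma bump_ge0 c r x : 0 <= bump c r x.
Proof. by apply: prodr_ge0 => j _; rewrite mulr_ge0 // flat_ge0. Qed.

Lemma bump_le1 c r x : bump c r x <= 1.
Proof.
rewrite /bump; apply: prodr_ile1 => j _.
by rewrite mulr_ge0 ?flat_ge0 //= mulr_ile1 ?flat_ge0 ?flat0_le1.
Qed.

Lemma bump_gt0 c r x : 0 < r -> (0 < bump c r x) <-> ball c r x.
Proof.
move=> r0; have -> : (0 < bump c r x) = [forall j : 'I_n, `|c ord0 j - x ord0 j| < r].
  rewrite lt0r bump_ge0 andbT; apply/prodf_neq0/forallP => h j.
    have /= := h j isT.
    rewrite mulf_eq0 negb_or => /andP[].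
    rewrite !neq_lt !ltNge !flat_ge0 /= -!ltNge !flat_gt0 ltr_norml => ? ?; lra.
  move=> _; have := h j; rewrite ltr_norml => /andP[h1 h2].
  by rewrite mulf_neq0 // gt_eqF // flat_gt0; lra.
split; first by move=> /forallP h; apply/ball_rVE.
by move=> /(ball_rVE _ _ r0) h; apply/forallP.
Qed.

Lemma finite_ball_cover K r : compact K -> 0 < r ->
  exists2 s : seq 'rV[R]_n, (forall c, c \in s -> K c) &
    forall x, K x -> exists2 c, c \in s & ball c r x.
Proof.
move=> cK r0; move: (cK); rewrite compact_cover => /(_ _ K (fun c => ball c r)).
case=> [c _|x Kx|D DK KD]; first exact: ball_open.
  by exists x => //; apply: ballxx; rewrite ?r0.
exists (finmap.enum_fset D) => [c cD|x /KD[c cD cx]].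
  by have := DK c cD; rewrite inE.
by exists c.
Qed.

(** A nonnegative test function that is at least 1 on K and whose p-th power has
    integral close to the measure of K. *)
Lemma exists_cutoff (p : R) K (e : R) : 1 <= p -> compact K -> 0 < e ->
  exists f, [/\ admissible K f, forall x, 0 <= f x &
    (Lnorm mu p%:E (EFin \o f) `^ p <= (fine (mu K) + e)%:E)%E].
Proof.
move=> p1 cK e0; have p0 : 0 < p by rewrite (lt_le_trans _ p1).
set m := fine (mu K).
have m0 : 0 <= m by rewrite fine_ge0.
have e20 : 0 < e / 2 by rewrite divr_gt0.
have [r r0 hr] := thickening_measure cK e20.
have [s sK sc] := finite_ball_cover cK r0.
pose G x := \prod_(c <- s) (1 + (-1) * bump c r x).
have G0 x : 0 <= G x.
  by apply: prodr_ge0 => c _; rewrite mulN1r subr_ge0 bump_le1.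
have G1 x : G x <= 1.
  by apply: prodr_ile1 => c _; rewrite mulN1r subr_ge0 bump_le1 gerBl bump_ge0.
have aG : flat_algebra G.
  apply: flat_algebra_prod => c; apply: flat_algebraD; first exact: flat_algebra_cst.
  by apply: flat_algebraM; [exact: flat_algebra_cst|exact: flat_algebra_bump].
have GK x : K x -> G x < 1.
  move=> /sc [c cs cx]; rewrite /G (big_rem c) //=.
  have b0 : 0 < bump c r x by apply/bump_gt0.
  apply: (@le_lt_trans _ _ (1 + (-1) * bump c r x)); last by rewrite mulN1r gtrBl.
  rewrite -[leRHS]mulr1; apply: ler_wpM2l.
    by rewrite mulN1r subr_ge0 bump_le1.
  by apply: prodr_ile1 => c' _; rewrite mulN1r subr_ge0 bump_le1 gerBl bump_ge0.
have [d [d0 d1 hd]] : exists d, [/\ 0 <= d, d < 1 & forall x, K x -> G x <= d].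
  have [ne|em] := pselect (K !=set0); last first.
    by exists 0; split => // x Kx; case: em; exists x.
  have [|c cK' hc] := EVT_max_rV ne cK (f := G).
    by apply: continuous_subspaceT; exact: flat_algebra_continuous.
  rewrite inE in cK'; exists (G c); split => //; first exact: GK.
  by move=> x Kx; apply: hc; rewrite inE.
(* the factor A makes up for the loss of height of 1 - G ^ N on K *)
pose A := (m + e) / (m + e / 2).
have me0 : 0 < m + e / 2 by rewrite ltr_wpDl.
have A1 : 1 < A by rewrite /A ltr_pdivlMr // mul1r ltrD2l; lra.
pose B := A `^ p^-1.
have B1 : 1 < B.
  apply: (@le_lt_trans _ _ (1 `^ p^-1)); first by rewrite powR1.
  by apply: gt0_ltr_powR; rewrite ?invr_gt0 ?nnegrE // ltW // (lt_trans _ A1).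
have B0 : 0 < B by rewrite (lt_trans _ B1).
have [N hN] : exists N : nat, d ^+ N <= 1 - B^-1.
  have t0 : 0 < 1 - B^-1 by rewrite subr_gt0 invf_lt1.
  have d1' : `|d| < 1 by rewrite ger0_norm.
  have /cvgrPdist_le/(_ _ t0)[N _ hN] := cvg_geometric 1 d1'.
  exists N; have := hN N (leqnn _).
  by rewrite /= sub0r normrN mul1r ger0_norm // exprn_ge0.
pose f x := B * (1 + (-1) * G x ^+ N).
have f0 x : 0 <= f x.
  by rewrite mulr_ge0 ?(ltW B0) // mulN1r subr_ge0 exprn_ile1.
have fB x : f x <= B.
  by rewrite ger_pMr // mulN1r gerBl exprn_ge0.
have fs x : f x != 0 -> thickening K r x.
  move=> fx; apply: contrapT => nx; move/eqP: fx; apply.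
  rewrite /f /G big_seq big1 ?expr1n ?mulN1r ?subrr ?mulr0 // => c cs.
  rewrite (_ : bump c r x = 0) ?mulr0 ?addr0 //.
  apply/eqP; rewrite eq_le bump_ge0 andbT leNgt; apply/negP => /(bump_gt0 _ _ r0) cx.
  by apply: nx; exists c => //; exact: sK.
exists f; split => //.
- split.
  + apply: flat_algebra_smooth; apply: flat_algebraM; first exact: flat_algebra_cst.
    apply: flat_algebraD; first exact: flat_algebra_cst.
    apply: flat_algebraM; first exact: flat_algebra_cst.
    exact: flat_algebra_exp.
  + have [M hM] := thickening_sub_cube cK r0.
    have cM := @cube_compact R n M.
    apply: (subclosed_compact _ cM); first exact: closed_closure.
    have clM : closed (@cube R n M) by apply: compact_closed => //; exact: norm_hausdorff.
    rewrite [X in _ `<=` X](closure_id _).1 //; apply: closure_subset => x fx.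
    exact/hM/fs.
  + move=> x Kx; have GN : G x ^+ N <= 1 - B^-1.
      by apply: le_trans hN; apply: lerXn2r; rewrite ?nnegrE ?hd.
    rewrite /f mulN1r; apply: (@le_trans _ _ (B * B^-1)).
      by rewrite mulfV ?gt_eqF.
    by rewrite ler_pM2l //; lra.
apply: (le_trans (@Lnorm_pow_le_indic _ _ _ p1 f (thickening K r) B _ _ _)).
- exact: thickening_measurable.
- exact: ltW.
- move=> x; rewrite indicE; have [xT|xT] := boolP (x \in _).
    by rewrite mulr1 ger0_norm.
  rewrite mulr0 normr_le0; apply: contraNT xT => /fs xT; by rewrite inE.
apply: (@le_trans _ _ ((B `^ p)%:E * (m + e / 2)%:E)%E).
  by apply: lee_wpmul2l => //; rewrite lee_fin powR_ge0.
rewrite -EFinM lee_fin -powRrM mulVf ?gt_eqF // powRr1 ?(ltW (lt_trans _ A1)) //.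
by rewrite divfK // gt_eqF.
Qed.

End cutoff.

(** * Asymptotics of the capacity *)

Section one_direction.
Variables (R : realType) (n : nat) (p : R).
Hypothesis p1 : 1 <= p.
Local Notation mu := (lebesgue_rV R n).
Local Notation "''N' f" := (Lnorm mu p%:E (EFin \o f)) (at level 8, f at level 2).
Implicit Types (f : 'rV[R]_n -> R) (K : set 'rV[R]_n) (k : 'I_n).

Let p0 : 0 < p. Proof. by rewrite (lt_le_trans _ p1). Qed.

Lemma Lnorm_diffN f (w : 'rV[R]_n) : measurable_fun setT f ->
  'N (fun x => f (x - w) - f x) = 'N (fun x => f (x + w) - f x).
Proof.
move=> mf; rewrite -(@Lnorm_shift _ _ _ p1 w (fun x => f (x - w) - f x)); last first.
  by apply: measurable_funB => //; exact: measurable_comp_shift.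
rewrite -[RHS]oppe_Lnorm; congr (Lnorm _ _ _); apply/funext => x /=.
by rewrite addrK opprB.
Qed.

Lemma Lnorm_diff_le_modulus f k (h t : R) : 0 <= h -> h <= t ->
  ('N (fun x => f (x + h *: unit_vector R k) - f x)%R <= partial_modulus k f t p)%E.
Proof.
by move=> h0 ht; apply: ereal_sup_ubound; exists h => //=; rewrite in_itv /= h0.
Qed.

Lemma separated_unit_vector K k (M : R) : 0 < M -> K `<=` cube M ->
  separated K ((2 * M + 1) *: unit_vector R k).
Proof.
move=> M0 KM m m0 x /KM/(_ k) x1 /KM/(_ k); rewrite !mxE !eqxx mulr1 => x2.
have m1 : 1 <= m%:R :> R by rewrite ler1n.
move: x1 x2; rewrite !ler_norml => /andP[x1 x1'] /andP[x2 x2'].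
by nra.
Qed.

(** At some scale t, depending on f and alpha, phi_k(t) t ^ (- alpha) is almost
    (2 |K|) ^ (1 / p): either trivially, or at one fixed scale X = 2 ^ s T at
    which the averages of f over translates have become small on K. *)
Lemma modulus_dichotomy K (d : R) : compact K -> 0 < d -> d < 1 ->
  exists2 a0, 0 < a0 & forall alpha, 0 < alpha < a0 ->
  forall f k, smooth f -> compactly_supported f -> (forall x, K x -> 1 <= f x) ->
  exists c, exists2 t, 0 < t & [/\ 0 <= c, (c%:E <= partial_modulus k f t p)%E &
    (2 * fine (mu K)) `^ p^-1 * (1 - d) <= c * t `^ (- alpha)].
Proof.
move=> cK d0 d1; set m := fine (mu K).
have m0 : 0 <= m by rewrite fine_ge0.
have mK : measurable K by exact: compact_measurable_rV.
have [M M0 KM] := compact_sub_cube cK.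
have Kfin : (mu K < +oo)%E by apply: (@lebesgue_rV_bounded _ _ _ M).
have [meq|mne] := eqVneq m 0.
  exists 1 => // alpha _ f k _ _ _; exists 0, 1 => //; split => //.
    exact: partial_modulus_ge0.
  by rewrite meq mulr0 powR0 ?invr_neq0 ?gt_eqF // !mul0r.
have mgt0 : 0 < m by rewrite lt0r mne.
set kappa := (2 * m) `^ p^-1.
have k0 : 0 <= kappa by exact: powR_ge0.
pose T := 2 * M + 1.
have T1 : 1 <= T by rewrite /T; lra.
have T0 : 0 < T by rewrite (lt_le_trans _ T1).
pose B := kappa * T.
have B0 : 0 <= B by rewrite mulr_ge0 // ltW.
set th : R := 2 `^ (- (2 * p)^-1).
have p20 : 0 < (2 * p)^-1 by rewrite invr_gt0 mulr_gt0.
have th1 : th < 1 by exact: two_powRN_lt1.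
have th0 : 0 <= th by exact: powR_ge0.
(* half of the loss d is spent on the averages, the rest on X ^ (- alpha) *)
pose eta := d / 2 * m `^ p^-1.
have mp0 : 0 < m `^ p^-1 by rewrite powR_gt0.
have eta0 : 0 < eta by rewrite mulr_gt0 // divr_gt0.
have [s hs] : exists s : nat, B * th ^+ s / (1 - th) <= eta.
  have tha : `|th| < 1 by rewrite ger0_norm.
  have /cvgrPdist_le/(_ _ eta0)[s _ hs] := cvg_geometric (B / (1 - th)) tha.
  exists s; have := hs s (leqnn _).
  rewrite /= sub0r normrN ger0_norm; first by rewrite mulrAC.
  by rewrite mulr_ge0 ?exprn_ge0 // mulr_ge0 // invr_ge0 subr_ge0 ltW.
pose X := 2 ^+ s * T.
have X1 : 1 <= X by rewrite /X mulr_ege1 // exprn_ege1 // ler1n.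
have X0 : 0 < X by rewrite (lt_le_trans _ X1).
pose rho := (1 - d) / (1 - d / 2).
have d20 : 0 < 1 - d / 2 by lra.
have rho0 : 0 < rho by rewrite divr_gt0 // subr_gt0.
have rho1 : rho < 1 by rewrite ltr_pdivrMr // mul1r; lra.
have lnX : 0 <= ln X by exact: ln_ge0.
have lnr : 0 < ln (rho^-1) by rewrite ln_gt0 // invf_gt1.
pose a1 := ln (rho^-1) / (ln X + 1).
have a10 : 0 < a1 by rewrite divr_gt0 // ltr_wpDl.
(* alpha < (2 p)^-1 makes the averages decay, alpha < 1 gives T ^ alpha <= T,
   and alpha < a1 gives rho <= X ^ (- alpha) *)
exists (Num.min (2 * p)^-1 (Num.min 1 a1)).
  by rewrite !lt_min p20 a10 ltr01.
move=> alpha; rewrite !lt_min => /andP[al0 /andP[alp /andP[al1 ala]]] f k sf cf f1.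
have hX : rho <= X `^ (- alpha).
  rewrite powRN -[leLHS]invrK lef_pV2 ?posrE ?powR_gt0 ?invr_gt0 //.
  rewrite /powR gt_eqF // -[leRHS]lnK ?posrE ?invr_gt0 // ler_expR.
  move: ala; rewrite /a1 ltr_pdivlMr ?ltr_wpDl // => /ltW; apply: le_trans.
  by rewrite ler_wpM2l ?(ltW al0) // lerDl.
have [[t t0 ht]|hall] := pselect (exists2 t : R, 0 < t &
    ((kappa * t `^ alpha)%:E <= partial_modulus k f t p)%E).
  exists (kappa * t `^ alpha), t => //; split => //.
    by rewrite mulr_ge0 // powR_ge0.
  rewrite -mulrA powRN divff ?mulr1; last by rewrite gt_eqF // powR_gt0.
  by rewrite ler_piMr // gerBl ltW.
have {}hall (t : R) : 0 < t -> (partial_modulus k f t p <= (kappa * t `^ alpha)%:E)%E.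
  move=> t0; have [//|lt] := leP (partial_modulus k f t p) (kappa * t `^ alpha)%:E.
  by exfalso; apply: hall; exists t => //; exact: ltW.
have contf := smooth_continuous sf.
have mf := continuous_measurable_rV contf.
have Nfin := Lnorm_lty p1 contf cf.
pose v := T *: unit_vector R k.
have sv : separated K v by exact: separated_unit_vector.
have hB (j : nat) : ('N (fun x => f (x + (2 ^ j)%:R *: v) - f x)%R <=
     (B * (2 ^+ j) `^ alpha)%:E)%E.
  rewrite /v scalerA natrX.
  have jT : 0 < 2 ^+ j * T by rewrite mulr_gt0 // exprn_gt0.
  apply: (le_trans (Lnorm_diff_le_modulus f k (ltW jT) (lexx _))).
  apply: (le_trans (hall _ jT)); rewrite lee_fin powRM ?exprn_ge0 ?(ltW T0) //.
  rewrite mulrA mulrAC /B; apply: ler_wpM2r; first exact: powR_ge0.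
  apply: ler_wpM2l => //; rewrite -[leRHS]powRr1 ?(ltW T0) //.
  by apply: ler_powR => //; exact: ltW.
have hBN (j : nat) : ('N (fun x => f (x + (2 ^ j)%:R *: - v) - f x)%R <=
     (B * (2 ^+ j) `^ alpha)%:E)%E.
  by rewrite scalerN Lnorm_diffN.
have decay := avg_decay p1 s mK sv mf Nfin B0 (ltW alp) hB.
have decayN := avg_decay p1 s mK (separatedN sv) mf Nfin B0 (ltW alp) hBN.
pose W := fine (partial_modulus k f X p).
have WE : partial_modulus k f X p = W%:E.
  rewrite fineK // ge0_fin_numE ?partial_modulus_ge0 ?(ltW X0) //.
  by rewrite (le_lt_trans (hall _ X0)) // ltry.
have W0 : 0 <= W by rewrite fine_ge0 // partial_modulus_ge0 // ltW.
have etam : eta <= m `^ p^-1 by rewrite /eta ger_pMl //; lra.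
have := @modulus_lower R n p p1 K v f s W eta mK Kfin sv mf f1 W0 (ltW eta0) etam.
have hW (i : nat) : (i < 2 ^ s)%N ->
     ('N (fun x => f (x + i%:R *: v) - f x)%R <= W%:E)%E.
  move=> i2; rewrite -WE /v scalerA; apply: Lnorm_diff_le_modulus.
    by rewrite mulr_ge0 // ltW.
  by rewrite ler_wpM2r ?(ltW T0) // -natrX ler_nat ltnW.
have hp : ('N (fun x => \1_K x * avg s v f x)%R <= eta%:E)%E.
  by apply: (le_trans decay); rewrite lee_fin.
have hm : ('N (fun x => \1_K x * avg s (- v) f x)%R <= eta%:E)%E.
  by apply: (le_trans decayN); rewrite lee_fin.
move=> /(_ hW hp hm) low.
have low' : kappa * (1 - d / 2) <= W.
  have : (2 * (m `^ p^-1 - eta) `^ p) `^ p^-1 <= (W `^ p) `^ p^-1.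
    apply: ge0_ler_powR; rewrite ?nnegrE ?mulr_ge0 ?powR_ge0 ?invr_ge0 ?(ltW p0) //.
  rewrite -(powRrM W) mulfV ?gt_eqF // powRr1 // powRM ?powR_ge0 //.
  rewrite -powRrM mulfV ?gt_eqF // powRr1 ?subr_ge0 //.
  rewrite /kappa powRM //; congr (_ <= _); rewrite /eta; ring.
exists W, X => //; split => //; first by rewrite WE.
apply: (@le_trans _ _ (kappa * (1 - d / 2) * rho)); last first.
  by apply: ler_pM => //; [rewrite mulr_ge0 // ltW|exact: ltW].
by rewrite -mulrA ler_wpM2l // /rho mulrC divfK // gt_eqF.
Qed.

End one_direction.

Section capacity.
Variables (R : realType) (n : nat) (p q : R).
Hypotheses (p1 : 1 <= p) (q1 : 1 <= q).
Local Notation mu := (lebesgue_rV R n).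
Implicit Types (f : 'rV[R]_n -> R) (K : set 'rV[R]_n).

Let p0 : 0 < p. Proof. by rewrite (lt_le_trans _ p1). Qed.
Let q0 : 0 < q. Proof. by rewrite (lt_le_trans _ q1). Qed.

Lemma besov_partial_ge0 alpha k f : (0 <= besov_partial alpha p q k f)%E.
Proof. exact: poweR_ge0. Qed.

(** How alpha scales out of the p-th power of a sum of n equal seminorms. *)
Lemma besov_scaling (alpha x : R) : 0 < alpha -> 0 <= x ->
  alpha `^ (p / q) * (n%:R * (x / alpha) `^ q^-1) `^ p =
  n%:R `^ p * x `^ (p / q).
Proof.
move=> a0 x0; rewrite powRM ?powR_ge0 // mulrCA; congr (_ * _).
rewrite -powRrM [q^-1 * p]mulrC -powRM ?divr_ge0 ?(ltW a0) //.
by rewrite mulrC divfK // gt_eqF.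
Qed.

Lemma capacity_lower K (d : R) : compact K -> 0 < d -> d < 1 ->
  exists2 a0, 0 < a0 & forall alpha, 0 < alpha < a0 ->
  ((2 * n%:R `^ p * (q^-1) `^ (p / q) * fine (mu K) * (1 - d) `^ p)%:E
   <= (alpha `^ (p / q))%:E * besov_capacity alpha p q K)%E.
Proof.
move=> cK d0 d1; have [a0 a00 ha] := modulus_dichotomy p1 cK d0 d1.
exists a0 => // alpha alpha0; have al0 : 0 < alpha by case/andP: alpha0.
set m := fine (mu K); have m0 : 0 <= m by rewrite fine_ge0.
pose c := (2 * m) `^ p^-1 * (1 - d).
have c0 : 0 <= c by rewrite mulr_ge0 ?powR_ge0 // subr_ge0 ltW.
pose y := (n%:R * (c `^ q / q / alpha) `^ q^-1) `^ p.
have -> : (2 * n%:R `^ p * (q^-1) `^ (p / q) * m * (1 - d) `^ p)%:E =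
    ((alpha `^ (p / q))%:E * y%:E)%E.
  rewrite -EFinM /y besov_scaling ?divr_ge0 ?powR_ge0 ?(ltW q0) //; congr EFin.
  rewrite powRM ?powR_ge0 ?invr_ge0 ?(ltW q0) // -powRrM.
  rewrite [q * _]mulrC divfK ?gt_eqF // /c powRM ?powR_ge0 ?subr_ge0 ?(ltW d1) //.
  rewrite -powRrM mulVf ?gt_eqF // powRr1 ?mulr_ge0 //; ring.
apply: lee_wpmul2l; first by rewrite lee_fin powR_ge0.
apply: le_ereal_inf_tmp => _ [f [sf cf f1] <-].
rewrite /y -poweR_EFin; apply: gt0_ler_poweR; first exact: ltW.
- by rewrite in_itv /= leey andbT lee_fin mulr_ge0 ?powR_ge0.
- by rewrite in_itv /= leey andbT sume_ge0 // => k _; exact: besov_partial_ge0.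
have -> : (n%:R * (c `^ q / q / alpha) `^ q^-1)%:E =
    (\sum_(k < n) ((c `^ q / q / alpha) `^ q^-1)%:E)%E.
  by rewrite sumEFin sumr_const card_ord mulr_natl.
apply: lee_sum => k _.
have [c' [t t0 [c'0 hc' ht]]] := ha alpha alpha0 f k sf cf f1.
apply: le_trans (besov_partial_lb al0 q1 c'0 t0 hc').
rewrite lee_fin; apply: ge0_ler_powR; rewrite ?nnegrE ?invr_ge0 ?(ltW q0) //;
  rewrite ?divr_ge0 ?powR_ge0 ?mulr_ge0 ?(ltW al0) ?(ltW q0) //.
rewrite -mulrA -invfM [q * alpha]mulrC ler_wpM2r ?invr_ge0 ?mulr_ge0 ?(ltW al0) ?(ltW q0) //.
by apply: ge0_ler_powR; rewrite ?nnegrE ?(ltW q0) // mulr_ge0 ?powR_ge0.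
Qed.

Lemma capacity_upper K (e : R) : compact K -> 0 < e ->
  \forall alpha \near (0 : R)^'+,
  ((alpha `^ (p / q))%:E * besov_capacity alpha p q K <=
   (2 * n%:R `^ p * (q^-1) `^ (p / q) * fine (mu K) + e)%:E)%E.
Proof.
move=> cK e0; set m := fine (mu K); have m0 : 0 <= m by rewrite fine_ge0.
set L := 2 * n%:R `^ p * (q^-1) `^ (p / q).
have L0 : 0 <= L by rewrite !mulr_ge0 ?powR_ge0.
(* L e' < e leaves room for the convergence of g to its limit L (m + e') *)
pose e' := e / 2 / (L + 1).
have L10 : 0 < L + 1 by rewrite ltr_wpDl.
have e'0 : 0 < e' by rewrite !divr_gt0.
have [f [[sf cf f1] f0 fI]] := exists_cutoff p1 cK e'0.
have mf := continuous_measurable_rV (smooth_continuous sf).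
pose W := (2 * (m + e')) `^ p^-1.
have me0 : 0 < m + e' by rewrite ltr_wpDl.
have W0 : 0 < W by rewrite powR_gt0 // mulr_gt0.
have /choice[C hC] : forall k : 'I_n, exists C, 0 <= C /\ forall t : R, 0 < t <= 1 ->
    (partial_modulus k f t p <= (C * t)%:E)%E.
  by move=> k; have [C C0 hC] := partial_modulus_lipschitz p1 k sf cf; exists C.
pose D := \sum_(k < n) C k.
have CD k : C k <= D.
  rewrite /D (bigD1 k) //= lerDl; apply: sumr_ge0 => i _; by case: (hC i).
have D0 : 0 <= D by apply: sumr_ge0 => i _; case: (hC i).
pose g alpha := n%:R `^ p * (alpha * (2 * D `^ q) + W `^ q / q) `^ (p / q).
have ub alpha : 0 < alpha -> alpha <= 2^-1 ->
    ((alpha `^ (p / q))%:E * besov_capacity alpha p q K <= (g alpha)%:E)%E.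
  move=> al0 alh.
  pose x := alpha * (2 * D `^ q) + W `^ q / q.
  have x0 : 0 <= x.
    by rewrite /x addr_ge0 ?divr_ge0 ?mulr_ge0 ?powR_ge0 ?(ltW al0) ?(ltW q0).
  rewrite /g -(besov_scaling al0 x0) EFinM; apply: lee_wpmul2l.
    by rewrite lee_fin powR_ge0.
  apply: ge_ereal_inf; exists (besov alpha p q f `^ p)%E; first by exists f.
  rewrite -poweR_EFin; apply: gt0_ler_poweR; first exact: ltW.
  - by rewrite in_itv /= leey andbT sume_ge0 // => k _; exact: besov_partial_ge0.
  - by rewrite in_itv /= leey andbT lee_fin mulr_ge0 ?powR_ge0.
  have -> : (n%:R * (x / alpha) `^ q^-1)%:E =
      (\sum_(k < n) ((x / alpha) `^ q^-1)%:E)%E.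
    by rewrite sumEFin sumr_const card_ord mulr_natl.
  apply: lee_sum => k _.
  apply: (le_trans (@besov_partial_ub R n alpha p q k f D W al0 alh q1 D0 (ltW W0) _ _)).
  - move=> t /andP[t0 t1]; have [C0 hCk] := hC k.
    apply: (le_trans (hCk t _)); first by rewrite t0.
    by rewrite lee_fin ler_wpM2r // ltW.
  - by move=> t t0; exact: partial_modulus_nonneg.
  rewrite lee_fin le_eqVlt; apply/orP; left; apply/eqP; congr (_ `^ _).
  by rewrite /x; field; rewrite !gt_eqF.
have cg : g alpha @[alpha --> (0 : R)^'+] --> n%:R `^ p * (W `^ q / q) `^ (p / q).
  apply: cvgMr.
  have E0 : 0 < W `^ q / q by rewrite divr_gt0 // powR_gt0.
  apply: (@cvg_comp _ _ _ (fun alpha => alpha * (2 * D `^ q) + W `^ q / q)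
    (@powR R ^~ (p / q)) _ (nbhs (W `^ q / q))); last exact: powR_continuous_gt0.
  apply: cvg_at_right_filter.
  rewrite -[X in _ --> X]add0r -[X in _ --> X + _](mul0r (2 * D `^ q)).
  by apply: cvgD; [apply: cvgMl; exact: cvg_id|exact: cvg_cst].
have limE : n%:R `^ p * (W `^ q / q) `^ (p / q) = L * (m + e').
  rewrite powRM ?powR_ge0 ?invr_ge0 ?(ltW q0) // -powRrM.
  rewrite [q * _]mulrC divfK ?gt_eqF // /W -powRrM mulVf ?gt_eqF //.
  rewrite powRr1 ?mulr_ge0 ?(ltW me0) // /L; ring.
have lt : n%:R `^ p * (W `^ q / q) `^ (p / q) < L * m + e.
  rewrite limE mulrDr ltrD2l /e' mulrA ltr_pdivrMr // mulrDr mulr1.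
  rewrite ltr_pwDr // mulrC ler_wpM2r //; lra.
near=> alpha.
apply: (@le_trans _ _ (g alpha)%:E).
  apply: ub; first by near: alpha; exact: nbhs_right_gt.
  by near: alpha; apply: nbhs_right_le; rewrite invr_gt0.
rewrite lee_fin; near: alpha; apply: (cvgr_le _ cg); exact: lt.
Unshelve. all: by end_near. Qed.

End capacity.

Theorem theorem4p1 (R : realType) (n : nat) (p q : R) (K : set 'rV[R]_n) :
  (0 < n)%N -> 1 <= p -> 1 <= q -> compact K ->
  ((alpha `^ (p / q))%:E * besov_capacity alpha p q K)%E @[alpha --> 0^'+] -->
  ((2 * n%:R `^ p * (q^-1) `^ (p / q))%:E * lebesgue_rV R n K)%E.
Proof.
move=> _ p1 q1 cK; have p0 : 0 < p by rewrite (lt_le_trans _ p1).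
set m := fine (lebesgue_rV R n K).
have m0 : 0 <= m by rewrite fine_ge0.
have mE : lebesgue_rV R n K = m%:E.
  have [M M0 KM] := compact_sub_cube cK; rewrite fineK // ge0_fin_numE //.
  by apply: (@lebesgue_rV_bounded _ _ _ M) => //; exact: compact_measurable_rV.
rewrite mE -EFinM; set L := _ * m.
have L0 : 0 <= L by rewrite !mulr_ge0 ?powR_ge0.
have key (e : R) : 0 < e -> \forall alpha \near (0 : R)^'+,
    ((L - e)%:E <= (alpha `^ (p / q))%:E * besov_capacity alpha p q K <= (L + e)%:E)%E.
  move=> e0.
  pose d := Num.min (2^-1) (e / (L + 1)).
  have L10 : 0 < L + 1 by rewrite ltr_wpDl.
  have d0 : 0 < d by rewrite lt_min invr_gt0 ltr0n /= divr_gt0.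
  have d1 : d < 1 by rewrite gt_min invf_lt1 // ltr1n.
  have Ld : L - e <= L * (1 - d).
    rewrite mulrBr mulr1 lerD2l lerN2; apply: (@le_trans _ _ (L * (e / (L + 1)))).
      by rewrite ler_wpM2l // ge_min lexx orbT.
    by rewrite mulrA ler_pdivrMr // mulrDr mulr1 mulrC lerDl ltW.
  (* d' is such that (1 - d') ^ p = 1 - d *)
  pose d' := 1 - (1 - d) `^ p^-1.
  have d0' : 0 < 1 - d by rewrite subr_gt0.
  have d'1 : d' < 1 by rewrite /d' gtrBl powR_gt0.
  have d'0 : 0 < d'.
    rewrite subr_gt0; apply: (@lt_le_trans _ _ (1 `^ p^-1)); last by rewrite powR1.
    by apply: gt0_ltr_powR; rewrite ?invr_gt0 ?nnegrE ?(ltW d0') // gtrBl.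
  have d'E : (1 - d') `^ p = 1 - d.
    by rewrite /d' subKr -powRrM mulVf ?gt_eqF // powRr1 // ltW.
  have [a0 a00 ha] := capacity_lower p1 q1 cK d'0 d'1.
  near=> alpha; apply/andP; split; last first.
    by near: alpha; exact: capacity_upper.
  apply: le_trans (ha alpha _).
    by rewrite lee_fin d'E.
  apply/andP; split; near: alpha; [exact: nbhs_right_gt|exact: nbhs_right_lt].
apply/fine_cvgP; split.
  have := key 1 ltr01; apply: filterS => alpha /andP[lo hi].
  rewrite fin_numElt (lt_le_trans _ lo) ?ltNyr //=.
  by rewrite (le_lt_trans hi) // ltry.
apply/cvgrPdist_le => e e0; have := key e e0; apply: filterS => alpha /andP[lo hi].
rewrite distrC ler_distl /=.
set x := ((alpha `^ (p / q))%:E * _)%E in lo hi *.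
have xE : x = (fine x)%:E.
  rewrite fineK // fin_numElt (lt_le_trans _ lo) ?ltNyr //=.
  by rewrite (le_lt_trans hi) // ltry.
by rewrite xE !lee_fin in lo hi; rewrite lo hi.
Unshelve. all: by end_near. Qed.
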